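(* Let $X$ and $Y$ be represented spaces and let $f:\subseteq X\rightrightarrows Y$ be a problem. Then the following are equivalent: (1) $f:\subseteq X\rightrightarrows Y$ is computable relative to the halting problem $0'$; (2) $f:\subseteq X_{\mathsf{H}}\rightrightarrows Y$ is computable; (3) $f:\subseteq X_{\mathsf{H}}\rightrightarrows Y_{\mathsf{H}}$ is computable; (4) $f:\subseteq X'\rightrightarrows Y'$ is computable; (5) $f:\subseteq X'\rightrightarrows Y'$ is low.
   Context: $F:\subseteq A\to B$ denotes a partial function, $f:\subseteq A\rightrightarrows B$ a partial multi-valued function (nonempty values on its domain). Compositions of partial functions have their natural domain. A representation of a set $X$ is a surjective partial function $\delta_X:\subseteq\mathbb{N}^{\mathbb{N}}\to X$; $(X,\delta_X)$ is then a represented space. A problem is a partial multi-valued function $f:\subseteq X\rightrightarrows Y$ between represented spaces. $F:\subseteq\mathbb{N}^{\mathbb{N}}\to\mathbb{N}^{\mathbb{N}}$ is a realizer of $f$ if $\delta_YF(p)\in f\delta_X(p)$ for all $p\in\mathrm{dom}(f\delta_X)$. A problem is computable, low, or computable relative to an oracle if it has a realizer with that property. A partial function $F:\subseteq\mathbb{N}^{\mathbb{N}}\to\mathbb{N}^{\mathbb{N}}$ is computable if there is a Turing machine (infinite input tape, one-way output tape) that on each $p\in\mathrm{dom}(F)$ produces $F(p)$ in the long run; nothing is required outside $\mathrm{dom}(F)$. It is computable relative to $q\in\mathbb{N}^{\mathbb{N}}$ if there is a computable $G$ with $F(p)=G\langle q,p\rangle$ for all $p\in\mathrm{dom}(F)$,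 where $\langle p,q\rangle(2n):=p(n)$, $\langle p,q\rangle(2n+1):=q(n)$. With $\langle n,k\rangle:=\frac12(n+k)(n+k+1)+k$ and $\langle p_0,p_1,\dots\rangle\langle n,k\rangle:=p_n(k)$, let $\lim:\subseteq\mathbb{N}^{\mathbb{N}}\to\mathbb{N}^{\mathbb{N}}$, $\langle p_0,p_1,\dots\rangle\mapsto\lim_{i\to\infty}p_i$ (product topology). The Turing jump $\mathsf{J}:\mathbb{N}^{\mathbb{N}}\to\mathbb{N}^{\mathbb{N}}$ is given by $\mathsf{J}(p)(i)=1$ if the $i$-th Turing machine halts upon input $p$, and $0$ otherwise; it is injective with partial inverse $\mathsf{J}^{-1}$. The halting problem is $0':=\mathsf{J}(000\dots)$. Let $\mathsf{L}:=\mathsf{J}^{-1}\circ\lim$; a partial function $F:\subseteq\mathbb{N}^{\mathbb{N}}\to\mathbb{N}^{\mathbb{N}}$ is low if $F=\mathsf{L}\circ G$ for some computable $G$. Let $\mathsf{H}:=\mathsf{J}\circ\lim^{-1}:\mathbb{N}^{\mathbb{N}}\rightrightarrows\mathbb{N}^{\mathbb{N}}$, so that $\mathsf{H}^{-1}=\lim\circ\mathsf{J}^{-1}$ is single-valued. For a represented space $(X,\delta_X)$: $X'$ is the set $X$ with representation $\delta_X\circ\lim$, and $X_{\mathsf{H}}$ is the set $X$ with representation $\delta_X\circ\mathsf{H}^{-1}=\delta_X\circ\lim\circ\mathsf{J}^{-1}$. In (2)–(5) the same multi-valued map $f$ is considered with respect to the changed representations. *)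

(* Defs.v *)
From mathcomp Require Import all_boot.
From mathcomp Require Import boolp classical_sets filter topology.

Set Implicit Arguments.
Unset Strict Implicit.
Unset Printing Implicit Defensive.

Local Open Scope classical_set_scope.

(* Partial functions are single-valued relations, and partial multi-valued    *)
(* functions are arbitrary relations [X -> Y -> Prop]; in both cases the      *)
(* domain consists of the points that are related to something.               *)
Record pfun (X Y : Type) := PFun {
  graph :> X -> Y -> Prop;
  graph_sv : forall x y y', graph x y -> graph x y' -> y = y'
}.

Definition mvdom X Y (f : X -> Y -> Prop) (x : X) := exists y, f x y.

Program Definition pcomp X Y Z (g : pfun Y Z) (f : pfun X Y) : pfun X Z :=
  PFun (graph := fun x z => exists2 y, f x y & g y z) _.
Next Obligation.
move=> X Y Z g f x z z' [y fxy gyz] [y' fxy' gy'z'].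
by move: gy'z'; rewrite -(graph_sv fxy fxy') => /(graph_sv gyz).
Qed.

Definition baire := nat -> nat.

Definition bpair (p q : baire) : baire :=
  fun n => if odd n then q n./2 else p n./2.

Definition cantor_pair (n k : nat) : nat := ((n + k) * (n + k + 1))./2 + k.

(* Turing machines have a read-only input tape (tape number 0), work tapes    *)
(* (numbers t > 0, of which a program mentions only finitely many) and a      *)
(* one-way output tape. Tapes are infinite to the right. A machine is given   *)
(* by its flowchart: line number [i] of the program is the action in state    *)
(* [i], and the machine halts when it enters a state outside of the program.  *)
(* Symbols are natural numbers, of which a program mentions only finitely     *)
(* many; 0 is the blank. The actions other than [Test] move on to the next    *)
(* state.                                                                     *)
Inductive instr : Type :=
| MoveL of nat                        (* tape; no effect on the leftmost cell *)
| MoveR of nat                                                        (* tape *)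
| Write of nat & nat                                          (* tape, symbol *)
| Emit of nat                                    (* symbol on the output tape *)
| Test of nat & nat & nat & nat.  (* tape, symbol, next state if the symbol   *)
                                  (* is scanned on the tape, else next state  *)

Definition machine := seq instr.

Record config := Config {
  state : nat;
  head : nat -> nat;
  cell : nat -> nat -> nat;
  output : seq nat
}.

Definition upd (A : Type) (f : nat -> A) (n : nat) (a : A) : nat -> A :=
  fun m => if m == n then a else f m.

Definition exec (i : instr) (c : config) : config :=
  let: Config s h w o := c in
  match i with
  | MoveL t => Config s.+1 (upd h t (h t).-1) w o
  | MoveR t => Config s.+1 (upd h t (h t).+1) w o
  | Write t a =>
      Config s.+1 h
        (if t == 0 then w else upd w t (upd (w t) (h t) a)) o
  | Emit a => Config s.+1 h w (rcons o a)
  | Test t a s1 s2 => Config (if w t (h t) == a then s1 else s2) h w o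
  end.

Definition step (M : machine) (c : config) : config :=
  if onth M (state c) is Some i then exec i c else c.

(* A sequence p of natural numbers is written on the input and output tapes   *)
(* as the infinite word 1^(p 0) 0 1^(p 1) 0 1^(p 2) 0 ...                     *)
Definition tally (p : baire) (n : nat) : seq nat :=
  flatten (mkseq (fun i => rcons (nseq (p i) 1) 0) n).

Definition tape_of (p : baire) (j : nat) : nat := nth 0 (tally p j.+1) j.

Definition init (p : baire) : config :=
  Config 0 (fun=> 0) (fun t => if t == 0 then tape_of p else fun=> 0) [::].

Definition run (M : machine) (p : baire) (t : nat) : config :=
  iter t (step M) (init p).

Definition halts (M : machine) (p : baire) : Prop :=
  exists t, size M <= state (run M p t).

Definition produces (M : machine) (p q : baire) : Prop :=
  forall n, exists t, prefix (tally q n) (output (run M p t)).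

(* [CodeSeq.decode] is a bijection from [nat] to [seq nat]. *)
Definition instr_of (c : nat) : instr :=
  let arg := nth 0 (CodeSeq.decode c) in
  match arg 0 with
  | 0 => MoveL (arg 1)
  | 1 => MoveR (arg 1)
  | 2 => Write (arg 1) (arg 2)
  | 3 => Emit (arg 1)
  | _ => Test (arg 1) (arg 2) (arg 3) (arg 4)
  end.

Definition machine_of (i : nat) : machine :=
  [seq instr_of c | c <- CodeSeq.decode i].

Lemma machine_of_surj M : exists i, machine_of i = M.
Proof.
have surj x : exists c, instr_of c = x.
  case: x => [t|t|t a|a|t a s1 s2];
  [exists (CodeSeq.code [:: 0; t]) | exists (CodeSeq.code [:: 1; t])
  |exists (CodeSeq.code [:: 2; t; a]) | exists (CodeSeq.code [:: 3; a])
  |exists (CodeSeq.code [:: 4; t; a; s1; s2])];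
  by rewrite /instr_of CodeSeq.codeK.
suff [s <-] : exists s, map instr_of s = M.
  by exists (CodeSeq.code s); rewrite /machine_of CodeSeq.codeK.
elim: M => [|x M [s <-]]; first by exists [::].
by have [c <-] := surj x; exists (c :: s).
Qed.

Definition computable (F : pfun baire baire) : Prop :=
  exists M : machine, forall p q, F p q -> produces M p q.

Definition computable_rel (q : baire) (F : pfun baire baire) : Prop :=
  exists2 G : pfun baire baire, computable G &
    forall p r, F p r -> G (bpair q p) r.

Definition column (r : baire) (i : nat) : baire :=
  fun k => r (cantor_pair i k).

(* [nat] carries the discrete topology and {ptws nat -> nat} is the product.  *)
Definition lim_graph (r p : baire) : Prop :=
  {ptws, column r @ \oo --> p}.

Lemma lim_graphP r p :
  lim_graph r p <->
  forall k, exists N, forall i, N <= i -> r (cantor_pair i k) = p k.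
Proof.
rewrite /lim_graph; split=> [/pointwise_cvgP rp k | rp].
  have /discrete_cvg[N _ Np] := rp k.
  by exists N => i Ni; apply: Np.
apply/pointwise_cvgP => k; apply/discrete_cvg.
by have [N Np] := rp k; exists N => // i Ni; apply: Np.
Qed.

Program Definition Lim : pfun baire baire := PFun (graph := lim_graph) _.
Next Obligation.
move=> r p p' /lim_graphP rp /lim_graphP rp'; apply/funext => k.
have [N Np] := rp k; have [N' Np'] := rp' k.
by rewrite -(Np (maxn N N')) ?leq_maxl// Np' ?leq_maxr.
Qed.

Definition J (p : baire) : baire :=
  fun i => if `[< halts (machine_of i) p >] then 1 else 0.

Definition halting_problem : baire := J (fun=> 0).

Lemma tallyS p n : tally p n.+1 = tally p n ++ rcons (nseq (p n) 1) 0.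
Proof. by rewrite /tally mkseqS flatten_rcons. Qed.

Lemma prefix_tally p m n : m <= n -> prefix (tally p m) (tally p n).
Proof.
move=> /subnKC <-; elim: (n - m) => [|d IHd]; first by rewrite addn0 prefix_refl.
by rewrite addnS tallyS; apply: prefix_trans IHd (prefix_prefix _ _).
Qed.

Lemma leq_size_tally p n : n <= size (tally p n).
Proof.
elim: n => // n IHn; rewrite tallyS size_cat size_rcons addnS ltnS.
exact: leq_trans IHn (leq_addr _ _).
Qed.

Lemma tape_ofE p n j :
  j < size (tally p n) -> tape_of p j = nth 0 (tally p n) j.
Proof.
move=> jn; rewrite /tape_of.
have jj : j < size (tally p j.+1) := leq_size_tally p j.+1.
have [|/ltnW] := leqP j.+1 n => /(prefix_tally p)/prefixP[s E].
  by rewrite E [RHS]nth_cat jj.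
by rewrite E [LHS]nth_cat jn.
Qed.

Lemma tape_of_inj : injective tape_of.
Proof.
move=> p q pq; pose agree n := tally p n = tally q n.
have noLt n p' q' : tape_of p' = tape_of q' -> tally p' n = tally q' n ->
    ~ p' n < q' n.
  move=> eqt eqn lt; pose j := size (tally p' n) + p' n.
  have := congr1 (@^~ j) eqt; rewrite /= !(@tape_ofE _ n.+1);
    rewrite ?(tallyS p' n) ?(tallyS q' n) ?size_cat ?size_rcons ?size_nseq;
    rewrite /j -?eqn ?ltn_add2l //.
    rewrite !nth_cat ![_ + _ < _]ltnNge !leq_addr /= addKn !nth_rcons.
    rewrite !size_nseq ltnn eqxx.
    by rewrite lt nth_nseq lt.
  by rewrite ltnS ltnW.
have step1 n : agree n -> p n = q n.
  by move=> pqn; have [/noLt|/noLt|//] := ltngtP (p n) (q n); case.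
apply/funext => n; apply: (step1 n); elim: n => // n IHn.
by rewrite /agree !tallyS (step1 _ IHn) IHn.
Qed.

Definition probe (j a : nat) : machine :=
  rcons (nseq j (MoveR 0)) (Test 0 a j.+1 j).

Lemma halts_probe j a p : halts (probe j a) p <-> tape_of p j = a.
Proof.
have onE s : s <= j ->
    onth (probe j a) s = Some (if s < j then MoveR 0 else Test 0 a j.+1 j).
  move=> sj; rewrite onthE map_rcons map_nseq nth_rcons size_nseq nth_nseq.
  by case: ltngtP sj.
have szE : size (probe j a) = j.+1 by rewrite size_rcons size_nseq.
pose inv s (c : config) := [/\ state c = s, head c 0 = s & cell c 0 = tape_of p].
have early t : t <= j -> inv t (run (probe j a) p t).
  elim: t => // t IHt tj; have [] := IHt (ltnW tj).
  rewrite /run /= -/(run _ _ _) /step; case: run => s h w o /= -> hE wE.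
  by rewrite onE ?(ltnW tj)// tj; split; rewrite //= /upd eqxx hE.
have late c : inv j c -> step (probe j a) c =
    Config (if tape_of p j == a then j.+1 else j) (head c) (cell c) (output c).
  rewrite /step; case: c => s h w o [/= -> hE wE].
  by rewrite onE// ltnn /= hE wE.
split=> [[t]|pj]; last first.
  by exists j.+1; rewrite szE /run /= -/(run _ _ _) (late _ (early _ _))// pj eqxx.
rewrite szE => jt; apply/eqP; apply: contraPT jt => /negPf pj; apply/negP.
rewrite -leqNgt; have [tj|/ltnW/subnKC <-] := leqP t j.
  by have [-> _ _] := early t tj.
suff [-> _ _] : inv j (run (probe j a) p (j + (t - j))) by [].
elim: (t - j) => [|d IHd]; first by rewrite addn0; apply: early.
rewrite addnS /run /= -/(run _ _ _) (late _ IHd) pj.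
by case: IHd => _ hE wE; split.
Qed.

Lemma J_inj : injective J.
Proof.
move=> p q pq; apply: tape_of_inj; apply/funext => j; apply/esym.
have [i iE] := machine_of_surj (probe j (tape_of p j)).
apply/halts_probe; have := congr1 (@^~ i) pq.
rewrite /J iE asboolT; last exact/halts_probe.
by case: ifP => // /asboolP.
Qed.

Program Definition Jinv : pfun baire baire :=
  PFun (graph := fun q p => J p = q) _.
Next Obligation. by move=> q p p' <- /J_inj. Qed.

Definition L : pfun baire baire := pcomp Jinv Lim.

Definition low (F : pfun baire baire) : Prop :=
  exists2 G : pfun baire baire, computable G &
    forall p q, F p q <-> pcomp L G p q.

Definition H (p q : baire) : Prop := exists2 r, Lim r p & J r = q.

Program Definition Hinv : pfun baire baire :=
  PFun (graph := fun q p => H p q) _.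
Next Obligation.
by move=> q p p' [r rp <-] [r' rp' /J_inj r'r]; move: rp'; rewrite r'r;
  apply: graph_sv.
Qed.

Lemma HinvE q p : Hinv q p <-> pcomp Lim Jinv q p.
Proof. by split=> -[r ? ?]; exists r. Qed.

Record rep_space := RepSpace {
  carrier :> Type;
  delta : pfun baire carrier;
  delta_surj : forall x, exists p, delta p x
}.

Lemma Lim_surj p : exists r, Lim r p.
Proof.
have pairK i k i' k' : cantor_pair i k = cantor_pair i' k' -> k = k'.
  have tri n : (n * (n + 1))./2 + n.+1 = (n.+1 * (n.+1 + 1))./2.
    have -> : n.+1 * (n.+1 + 1) = n.+1.*2 + n * (n + 1).
      by rewrite !addn1 -(addn2 n) mulnDr muln2 addnC [n.+1 * n]mulnC.
    by rewrite halfD odd_double andFb doubleK add0n addnC.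
  have mono m n : m <= n -> (m * (m + 1))./2 <= (n * (n + 1))./2.
    by move=> mn; apply: half_leq; rewrite leq_mul// leq_add2r.
  have noLt a b a' b' : a + b < a' + b' -> cantor_pair a b < cantor_pair a' b'.
    move=> /mono; rewrite -tri /cantor_pair => le.
    apply: leq_trans (leq_addr _ _); apply: leq_trans le.
    by rewrite -addnS leq_add2l ltnS leq_addl.
  move=> e; have [/noLt|/noLt|s] := ltngtP (i + k) (i' + k');
    rewrite ?e ?ltnn//.
  by move: e; rewrite /cantor_pair s => /addnI.
pose good n k := exists i, cantor_pair i k = n.
have /choice[g gP] n : exists v, forall k, good n k -> v = p k.
  have [[k [i <-]]|no] := pselect (exists k, good n k).
    by exists (p k) => k' [i' /pairK ->].
  by exists 0 => k gk; case: no; exists k.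
exists g; apply/lim_graphP => k; exists 0 => i _.
by apply: gP; exists i.
Qed.

(* The space X': the set X with the representation delta \o lim.              *)
Program Definition lim_space (X : rep_space) : rep_space :=
  RepSpace (carrier := X) (delta := pcomp (delta X) Lim) _.
Next Obligation.
move=> X x; have [p px] := delta_surj x.
by have [r rp] := Lim_surj p; exists r, p.
Qed.

(* The space X_H: the set X with the representation delta \o H^-1.            *)
Program Definition H_space (X : rep_space) : rep_space :=
  RepSpace (carrier := X) (delta := pcomp (delta X) Hinv) _.
Next Obligation.
move=> X x; have [p px] := delta_surj x.
have [r rp] := Lim_surj p.
by exists (J r), p => //; exists r.
Qed.

Definition problem (X Y : rep_space) : Type := X -> Y -> Prop.

Definition realizer (X Y : rep_space) (f : problem X Y) (F : pfun baire baire)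
    : Prop :=
  forall p x, delta X p x -> mvdom f x ->
    exists q y, [/\ F p q, delta Y q y & f x y].

Definition problem_computable (X Y : rep_space) (f : problem X Y) : Prop :=
  exists2 F, realizer f F & computable F.

Definition problem_computable_rel (q : baire) (X Y : rep_space)
    (f : problem X Y) : Prop :=
  exists2 F, realizer f F & computable_rel q F.

Definition problem_low (X Y : rep_space) (f : problem X Y) : Prop :=
  exists2 F, realizer f F & low F.

Arguments problem_computable : clear implicits.
Arguments problem_computable_rel : clear implicits.
Arguments problem_low : clear implicits.

(* Main.v *)
Require Import Defs.
From mathcomp Require Import all_boot.
From mathcomp Require Import boolp zify.

Set Implicit Arguments.
Unset Strict Implicit.
Unset Printing Implicit Defensive.

(* Everything is compared with computability relative to the jump J(r) of a   *)
(* name r. The jump J(r) computes 0'; it computes lim r, because it decides    *)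
(* whether a column has stabilized from some position on; and it computes J(s) *)
(* for every s computable from r. Conversely, by the limit lemma, whatever     *)
(* J(r) computes is the limit of a sequence computable from r. This yields     *)
(* (1) => (2) => (3) => (4) => (5). For (5) => (1), a name p is replaced by a  *)
(* sequence r with limit p whose jump is computable from 0' and p: finite      *)
(* pieces of r are chosen such that the e-th machine halts on the e-th piece   *)
(* whenever this is compatible with setting all later entries of the columns   *)
(* k < e to p(k), and 0' decides whether it is. Applied to r, a low realizer   *)
(* yields a value that is computable from J(r).                                *)
(*                                                                             *)
(* At the level of Turing machines only two things are needed: that the run of *)
(* a machine for s steps is a function of the first s numbers of the input     *)
(* that a counter program computes, and that there are machines that evaluate  *)
(* such a function on longer and longer prefixes of the input.                 *)

(** Write a <= b when a is computable from b, uniformly in the name at hand. Three facts carry (1)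
    => ... => (5). If q <= o, then J(q) <= J(o) ([cfun_jump]). If o converges to q, then q <= J(o)
    ([cfun_lim]). If q <= J(o), then q is the limit of some s <= o ([cfun_limit_approximation]).

    Let r be a name with limit p. For (2), J(r) computes both 0' and p. For (3), the value q <= J(r)
    is the limit of some s <= r, and J(s) <= J(r) is a name for the jump representation. For (4),
    J(r) computes some J(t) with q = lim t, hence q, which is therefore the limit of a sequence
    computable from r. For (5), the output s <= r of (4) satisfies J(s) <= J(r), so J(s) is again a
    limit of a sequence computable from r.

    For (1), J(r) must be bounded by 0' and p. This fails for arbitrary r, but holds for a suitable
    one with limit p ([Lim_generic], [cfun_J_generic]). On it a low realizer computes u <= r with
    limit J(t), and J(r) computes J(u), then J(t), then lim t.

    All of this is argued with semidecidable graphs ([sigma], [cfun]); [cfun_produces] and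
    [produces_cfun] translate from machines and back. *)

(** * Counter programs and their compilation to Turing machines *)

(* The value of register t > 0 is the head position on work tape t. The     *)
(* leftmost cell of the tape is marked with 1 so that zero can be tested for. *)
(* Register 0 is the position on the input tape.                              *)
Inductive cmd :=
| Skip
| Inc of nat
| Dec of nat
| Out of nat
| Seq of cmd & cmd
| If of nat & nat & cmd & cmd
| Until of nat & nat & cmd.

Notation "c1 ;; c2" := (Seq c1 c2) (at level 60, right associativity).

(** Jump targets are absolute, so the code depends on the address [b] at which it is placed. An
    unconditional jump is a [Test] with two equal targets. *)
Fixpoint compile (b : nat) (c : cmd) : machine :=
  match c with
  | Skip => [::]
  | Inc t => [:: MoveR t]
  | Dec t => [:: MoveL t]
  | Out a => [:: Emit a]
  | Seq c1 c2 =>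
      compile b c1 ++ compile (b + size (compile b c1)) c2
  | If t a c1 c2 =>
      let m1 := compile b.+1 c1 in
      let m2 := compile (b + size m1).+2 c2 in
      let stop := (b + size m1).+2 + size m2 in
      Test t a b.+1 (b + size m1).+2 :: rcons m1 (Test 0 0 stop stop) ++ m2
  | Until t a c =>
      let m := compile b.+1 c in
      Test t a (b + size m).+2 b.+1 :: rcons m (Test 0 0 b b)
  end.

Definition code_at (M : machine) (b : nat) (m : machine) :=
  exists l r, M = l ++ m ++ r /\ size l = b.

Lemma code_at_catl M b m1 m2 : code_at M b (m1 ++ m2) -> code_at M b m1.
Proof. by move=> [l [r [-> <-]]]; exists l, (m2 ++ r); rewrite -catA. Qed.

Lemma code_at_catr M b m1 m2 :
  code_at M b (m1 ++ m2) -> code_at M (b + size m1) m2.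
Proof.
move=> [l [r [-> <-]]]; exists (l ++ m1), r.
by rewrite size_cat !catA.
Qed.

Lemma code_at_cons M b i m :
  code_at M b (i :: m) -> onth M b = Some i /\ code_at M b.+1 m.
Proof.
move=> Mm; have := Mm; rewrite -cat1s => /code_at_catr; rewrite addn1; split=> //.
by case: Mm => l [r [-> <-]]; rewrite onth_cat ltnn subnn.
Qed.

Lemma code_at_rcons M b m i :
  code_at M b (rcons m i) -> code_at M b m /\ onth M (b + size m) = Some i.
Proof.
rewrite -cats1 => Mm; split; first exact: code_at_catl Mm.
by have [] := code_at_cons (code_at_catr Mm).
Qed.

Definition reaches (M : machine) (c c' : config) :=
  exists t, iter t (step M) c = c'.

Lemma reaches_refl M c : reaches M c c.
Proof. by exists 0. Qed.

Lemma reaches_trans M c1 c2 c3 :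
  reaches M c1 c2 -> reaches M c2 c3 -> reaches M c1 c3.
Proof. by move=> [s <-] [t <-]; exists (t + s); rewrite iterD. Qed.

Lemma reaches_step M i b h w o c' : onth M b = Some i ->
  reaches M (exec i (Config b h w o)) c' -> reaches M (Config b h w o) c'.
Proof.
move=> Mi; apply: reaches_trans; exists 1.
by rewrite /= /step Mi.
Qed.

Definition store := ((nat -> nat) * seq nat)%type.

(** Compiled code never writes on a tape, so the tape contents [W] stay fixed; only head positions
    and output change. *)
Definition runs (W : nat -> nat -> nat) (c : cmd) (s s' : store) :=
  forall M b, code_at M b (compile b c) ->
    reaches M (Config b s.1 W s.2)
      (Config (b + size (compile b c)) s'.1 W s'.2).

Definition wp (W : nat -> nat -> nat) (c : cmd) (Q : store -> Prop) s :=
  exists2 s', runs W c s s' & Q s'.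

Section WeakestPreconditions.
Variable W : nat -> nat -> nat.
Implicit Types (Q : store -> Prop) (e : nat -> nat) (o : seq nat).

Lemma wp_weaken c Q Q' s : wp W c Q s -> (forall s', Q s' -> Q' s') -> wp W c Q' s.
Proof. by move=> [s' ss' Qs'] QQ'; exists s' => //; apply: QQ'. Qed.

Lemma wp_skip Q s : Q s -> wp W Skip Q s.
Proof. by exists s => // M b _; rewrite addn0; apply: reaches_refl. Qed.

Lemma wp_inc t Q e o : Q (upd e t (e t).+1, o) -> wp W (Inc t) Q (e, o).
Proof.
move=> Qs; eexists; last exact: Qs.
move=> M b /code_at_cons[Mb _]; apply: (reaches_step Mb).
by rewrite addn1; apply: reaches_refl.
Qed.

Lemma wp_dec t Q e o : Q (upd e t (e t).-1, o) -> wp W (Dec t) Q (e, o).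
Proof.
move=> Qs; eexists; last exact: Qs.
move=> M b /code_at_cons[Mb _]; apply: (reaches_step Mb).
by rewrite addn1; apply: reaches_refl.
Qed.

Lemma wp_out a Q e o : Q (e, rcons o a) -> wp W (Out a) Q (e, o).
Proof.
move=> Qs; eexists; last exact: Qs.
move=> M b /code_at_cons[Mb _]; apply: (reaches_step Mb).
by rewrite addn1; apply: reaches_refl.
Qed.

Lemma wp_seq c1 c2 Q s : wp W c1 (wp W c2 Q) s -> wp W (c1 ;; c2) Q s.
Proof.
move=> [s1 ss1 [s2 s1s2 Qs2]]; exists s2 => // M b /= Mc.
apply: reaches_trans (ss1 _ _ (code_at_catl Mc)) _.
by rewrite size_cat addnA; apply: s1s2; apply: code_at_catr Mc.
Qed.

Lemma wp_if t a c1 c2 Q s :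
  (if W t (s.1 t) == a then wp W c1 Q s else wp W c2 Q s) ->
  wp W (If t a c1 c2) Q s.
Proof.
have sizeE b : b + size (compile b (If t a c1 c2)) =
    (b + size (compile b.+1 c1)).+2
      + size (compile (b + size (compile b.+1 c1)).+2 c2).
  by rewrite /= size_cat size_rcons !addSn !addnS addnA.
case: ifP => Wta [s' ss' Qs']; exists s' => // M b; rewrite sizeE /=;
  move=> /code_at_cons[Mb Mc]; apply: (reaches_step Mb) => /=; rewrite Wta.
  have [Mc1 Mgoto] := code_at_rcons (code_at_catl Mc).
  apply: reaches_trans (ss' _ _ Mc1) _; apply: (reaches_step Mgoto) => /=.
  by rewrite if_same; apply: reaches_refl.
apply: ss'; have := code_at_catr Mc; by rewrite size_rcons addnS.
Qed.

Lemma wp_until_stop t a c Q s : W t (s.1 t) = a -> Q s -> wp W (Until t a c) Q s.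
Proof.
move=> Wta Qs; exists s => // M b /= /code_at_cons[Mb _].
apply: (reaches_step Mb) => /=; rewrite Wta eqxx size_rcons !addnS.
exact: reaches_refl.
Qed.

Lemma wp_until_next t a c Q s :
  W t (s.1 t) <> a -> wp W c (wp W (Until t a c) Q) s -> wp W (Until t a c) Q s.
Proof.
move=> /eqP/negPf Wta [s1 ss1 [s2 s1s2 Qs2]]; exists s2 => // M b Mc.
have /code_at_cons[Mb /code_at_rcons[Mbody Mgoto]] := Mc.
apply: (reaches_step Mb) => /=; rewrite Wta.
apply: reaches_trans (ss1 _ _ Mbody) _.
apply: (reaches_step Mgoto) => /=; rewrite if_same.
exact: s1s2 Mc.
Qed.

Definition marked (R : nat) :=
  forall t x, 0 < t <= R -> W t x = (x == 0).

Lemma markedW R R' : R' <= R -> marked R -> marked R'.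
Proof. by move=> R'R WR t x /andP[t0 tR']; apply: WR; rewrite t0 (leq_trans tR'). Qed.

(** The register [x] is the variant: each pass lowers it by one, and its value indexes the
    invariant. *)
Lemma wp_loop x c R (Inv : nat -> store -> Prop) k s :
  marked R -> 0 < x <= R ->
  (forall k s, Inv k s -> s.1 x = k) ->
  (forall k s, Inv k.+1 s -> wp W c (Inv k) s) ->
  Inv k s -> wp W (Until x 1 c) (Inv 0) s.
Proof.
move=> WR xR Invx Invc; elim: k s => [|k IHk] s Is.
  by apply: wp_until_stop => //; rewrite WR// (Invx _ _ Is).
apply: wp_until_next; first by rewrite WR// (Invx _ _ Is).
exact: wp_weaken (Invc _ _ Is) IHk.
Qed.

End WeakestPreconditions.

Ltac regs :=
  rewrite /upd /=; repeat (case: eqP => [?|?]; try (exfalso; lia)); try lia.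
Ltac stores := congr pair; apply/funext => ?; rewrite /upd /=;
  repeat (case: eqP => [?|?] //=; subst => //=); try lia.

Definition Clear x := Until x 1 (Dec x).
Definition Move x y := Until x 1 (Dec x ;; Inc y).
Definition Move2 x y z := Until x 1 (Dec x ;; Inc y ;; Inc z).
Definition Copy x y t := Clear y ;; Clear t ;; Move2 x y t ;; Move t x.

Section Macros.
Variables (W : nat -> nat -> nat) (R : nat).
Hypothesis WR : marked W R.
Implicit Types (Q : store -> Prop) (e : nat -> nat) (o : seq nat).

Lemma wp_clear x Q e o :
  0 < x <= R -> Q (upd e x 0, o) -> wp W (Clear x) Q (e, o).
Proof.
move=> xR Qs.
apply: (@wp_weaken _ _ (fun s => s = (upd e x 0, o))) => [|_ -> //].
apply: (wp_loop (Inv := fun k s => s = (upd e x k, o)) (k := e x) WR xR).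
- by move=> k _ ->; rewrite /= /upd eqxx.
- by move=> k _ ->; apply: wp_dec; stores.
- by stores.
Qed.

Lemma wp_move x y Q e o : 0 < x <= R -> x != y ->
  Q (upd (upd e y (e y + e x)) x 0, o) -> wp W (Move x y) Q (e, o).
Proof.
move=> xR /eqP xy Qs.
(* The store when [k] units are left in [x]; the bound [k <= e x] in the invariant keeps the
   truncated subtraction exact. *)
pose S k := (upd (upd e y (e y + e x - k)) x k, o).
apply: (@wp_weaken _ _ (fun s => s = S 0)) => [|_ ->]; last by rewrite /S subn0.
suff: wp W (Move x y) (fun s => s = S 0 /\ 0 <= e x) (e, o).
  by move=> /wp_weaken; apply => s [].
apply: (wp_loop (Inv := fun k s => s = S k /\ k <= e x) (k := e x) WR xR).
- by move=> k _ [-> _]; rewrite /= /upd eqxx.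
- move=> k _ [-> kx]; apply: wp_seq; apply: wp_dec; apply: wp_inc; split; last lia.
  by rewrite /S; stores.
- by split=> //; rewrite /S; stores.
Qed.

Lemma wp_move2 x y z Q e o : 0 < x <= R -> x != y -> x != z -> y != z ->
  Q (upd (upd (upd e y (e y + e x)) z (e z + e x)) x 0, o) ->
  wp W (Move2 x y z) Q (e, o).
Proof.
move=> xR /eqP xy /eqP xz /eqP yz Qs.
pose S k := (upd (upd (upd e y (e y + e x - k)) z (e z + e x - k)) x k, o).
apply: (@wp_weaken _ _ (fun s => s = S 0)) => [|_ ->]; last by rewrite /S !subn0.
suff: wp W (Move2 x y z) (fun s => s = S 0 /\ 0 <= e x) (e, o).
  by move=> /wp_weaken; apply => s [].
apply: (wp_loop (Inv := fun k s => s = S k /\ k <= e x) (k := e x) WR xR).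
- by move=> k _ [-> _]; rewrite /= /upd eqxx.
- move=> k _ [-> kx]; apply: wp_seq; apply: wp_dec.
  apply: wp_seq; apply: wp_inc; apply: wp_inc; split; last lia.
  by rewrite /S; stores.
- by split=> //; rewrite /S; stores.
Qed.

Lemma wp_copy x y t Q e o :
  0 < x <= R -> 0 < y <= R -> 0 < t <= R -> x != y -> x != t -> y != t ->
  Q (upd (upd e y (e x)) t 0, o) -> wp W (Copy x y t) Q (e, o).
Proof.
move=> xR yR tR xy xt yt Qs.
apply: wp_seq; apply: wp_clear => //; apply: wp_seq; apply: wp_clear => //.
apply: wp_seq; apply: wp_move2 => //; apply: wp_move; rewrite 1?eq_sym//.
move: Qs; congr Q; move/eqP: xy; move/eqP: xt; move/eqP: yt => *; stores.
Qed.

End Macros.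

(** * Functions computed by counter programs *)

(* The program finds the argument in register b, leaves the value there and  *)
(* uses the registers above b for scratch.                                    *)
Definition prim (f : nat -> nat) :=
  forall b, 0 < b -> exists c R, forall W, marked W R -> forall e o,
    wp W c (fun s => [/\ s.2 = o, s.1 b = f (e b) & forall j, j < b -> s.1 j = e j])
      (e, o).

Lemma prim_id : prim id.
Proof. by move=> b _; exists Skip, 0 => W _ e o; apply: wp_skip. Qed.

Lemma prim_cst a : prim (fun=> a).
Proof.
move=> b b0; elim: a => [|a [c [R cP]]].
  exists (Clear b), b => W Wb e o; apply: (wp_clear Wb); first lia.
  by split=> // [|j jb]; regs.
exists (c ;; Inc b), R => W WR e o; apply: wp_seq.
apply: wp_weaken (cP W WR e o) _ => -[e' _] /= [-> e'b e'j].
by apply: wp_inc; split=> // [|j jb]; rewrite ?e'b; regs; rewrite e'j.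
Qed.

Lemma prim_succ : prim S.
Proof.
move=> b _; exists (Inc b), 0 => W _ e o; apply: wp_inc.
by split=> // [|j jb]; regs.
Qed.

Lemma prim_comp g f : prim g -> prim f -> prim (fun x => g (f x)).
Proof.
move=> pg pf b b0; have [[c [R cP]] [c' [R' c'P]]] := (pf b b0, pg b b0).
exists (c ;; c'), (maxn R R') => W WR e o; apply: wp_seq.
apply: wp_weaken (cP W (markedW (leq_maxl _ _) WR) e o) _.
move=> -[e' _] /= [-> e'b e'j].
apply: wp_weaken (c'P W (markedW (leq_maxr _ _) WR) e' o) _.
move=> -[e'' _] /= [-> e''b e''j]; split=> //=; first by rewrite e''b e'b.
by move=> j jb; rewrite e''j ?e'j.
Qed.

(** With n in [b.+1] and k in [b.+2], the triangular number is added up term by term: register [b]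
    collects k + (n + k) + (n + k - 1) + ... + 1. *)
Definition Pair b :=
  Copy b.+2 b b.+3 ;; Move b.+1 b.+2 ;;
  Until b.+2 1 (Copy b.+2 b.+3 b.+4 ;; Move b.+3 b ;; Dec b.+2).

Definition triangle n := (n * (n + 1))./2.
Arguments triangle : simpl never.

Lemma triangleS n : triangle n.+1 = triangle n + n.+1.
Proof. by rewrite /triangle; lia. Qed.

Lemma cantor_pairE n k : cantor_pair n k = triangle (n + k) + k.
Proof. by []. Qed.

Lemma wp_pair W b Q e o : 0 < b -> marked W b.+4 ->
  (forall e', e' b = cantor_pair (e b.+1) (e b.+2) ->
     (forall j, j < b -> e' j = e j) -> Q (e', o)) ->
  wp W (Pair b) Q (e, o).
Proof.
move=> b0 Wb Qe; pose n := e b.+1; pose k := e b.+2.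
apply: wp_seq; apply: (wp_copy Wb); try lia.
apply: wp_seq; apply: (wp_move Wb); try lia.
pose Inv (s : nat) (u : store) := [/\ u.2 = o, u.1 b.+2 = s,
  u.1 b + triangle s = cantor_pair n k & forall j, j < b -> u.1 j = e j].
apply: (@wp_weaken _ _ (Inv 0)) => [|[e' _] [/= -> _ e'b e'j]]; last first.
  by apply: Qe => //; move: e'b; rewrite addn0.
apply: (wp_loop (k := n + k) Wb); first lia.
- by move=> s u [].
- move=> s [e' _] [/= -> e's e'b e'j].
  apply: wp_seq; apply: (wp_copy Wb); try lia.
  apply: wp_seq; apply: (wp_move Wb); try lia.
  apply: wp_dec; split=> //=; [by regs; rewrite e's| |by move=> j jb; regs; rewrite e'j].
  by rewrite -e'b triangleS; regs; rewrite ?e's; lia.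
- split=> //; [| |by move=> j jb; regs].
  + by rewrite /n /k; regs; lia.
  + by rewrite cantor_pairE /n /k; regs; rewrite addnC [_ b.+2 + _]addnC.
Qed.

Lemma prim_pair f g : prim f -> prim g -> prim (fun x => cantor_pair (f x) (g x)).
Proof.
move=> pf pg b b0; have [c [R cP]] := pf b.+1 isT; have [c' [R' c'P]] := pg b.+2 isT.
exists (Copy b b.+1 b.+2 ;; c ;; Copy b b.+2 b.+3 ;; c' ;; Pair b),
  (maxn (maxn R R') b.+4) => W WR e o.
have Wb : marked W b.+4 by apply: markedW WR; lia.
have WRc : marked W R by apply: markedW WR; lia.
have WRc' : marked W R' by apply: markedW WR; lia.
apply: wp_seq; apply: (wp_copy Wb); try lia.
apply: wp_seq; apply: wp_weaken (cP W WRc _ o) _ => -[e1 _] /= [-> e1b e1j].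
apply: wp_seq; apply: (wp_copy Wb); try lia.
apply: wp_seq; apply: wp_weaken (c'P W WRc' _ o) _ => -[e2 _] /= [-> e2b e2j].
have e1bb : e1 b = e b by rewrite e1j //; regs.
apply: wp_pair => // e3 e3b e3j; split=> //=.
  rewrite e3b e2b (e2j b.+1)//; congr (cantor_pair _ (g _)); last by regs.
  by regs; rewrite e1b; regs.
move=> j jb; rewrite e3j// e2j; last by lia.
regs; rewrite e1j; last by lia.
by regs.
Qed.

(* The Cantor pairing enumerates the diagonals one after the other.           *)
Definition next_pair (u : nat * nat) :=
  if u.1 is n.+1 then (n, u.2.+1) else (u.2.+1, 0).

Definition unpair x := iter x next_pair (0, 0).
Definition pi1 x := (unpair x).1.
Definition pi2 x := (unpair x).2.

Lemma cantor_next u :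
  cantor_pair (next_pair u).1 (next_pair u).2 = (cantor_pair u.1 u.2).+1.
Proof.
case: u => -[|n] k; rewrite !cantor_pairE /=.
  by rewrite !addn0 add0n triangleS; lia.
by rewrite addSnnS addnS.
Qed.

Lemma cantor_unpair x : cantor_pair (pi1 x) (pi2 x) = x.
Proof.
elim: x => // x IHx; rewrite -[in RHS]IHx /pi1 /pi2 /unpair iterS.
exact: cantor_next.
Qed.

Lemma unpairK n k : unpair (cantor_pair n k) = (n, k).
Proof.
move sE : (n + k) => s; elim: s n k sE => [|s IHs] n k; first by case: n k => [] [].
elim: k n => [|k IHk] n nk.
  move: nk; rewrite addn0 => ->; have /= -> := cantor_next (0, s).
  by rewrite /unpair iterS -/(unpair _) (IHs 0 s).
have /= E := cantor_next (n.+1, k); rewrite E /unpair iterS -/(unpair _).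
by rewrite IHk // -nk addSnnS.
Qed.

Lemma pi1K n k : pi1 (cantor_pair n k) = n.
Proof. by rewrite /pi1 unpairK. Qed.

Lemma pi2K n k : pi2 (cantor_pair n k) = k.
Proof. by rewrite /pi2 unpairK. Qed.

Lemma cantor_pair_ge1 n k : n <= cantor_pair n k.
Proof.
rewrite cantor_pairE; apply: leq_trans (leq_addr _ _).
apply: (@leq_trans (n + k)); first exact: leq_addr.
by elim: (n + k) => // s IHs; rewrite triangleS; lia.
Qed.

Definition Unpair b := Clear b.+1 ;; Clear b.+2 ;;
  Until b 1 (Dec b ;; If b.+1 1 (Move b.+2 b.+1 ;; Inc b.+1) (Dec b.+1 ;; Inc b.+2)).

Lemma wp_unpair W b Q e o : 0 < b -> marked W b.+2 ->
  Q (upd (upd (upd e b 0) b.+1 (pi1 (e b))) b.+2 (pi2 (e b)), o) ->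
  wp W (Unpair b) Q (e, o).
Proof.
move=> b0 Wb Qe.
apply: wp_seq; apply: (wp_clear Wb); first lia.
apply: wp_seq; apply: (wp_clear Wb); first lia.
pose u s := unpair (e b - s).
pose S s := (upd (upd (upd e b s) b.+1 (u s).1) b.+2 (u s).2, o).
apply: (@wp_weaken _ _ (fun v => v = S 0 /\ 0 <= e b)) => [|_ [-> _]]; last first.
  by move: Qe; rewrite /S /u subn0.
apply: (wp_loop (Inv := fun k s => s = S k /\ k <= e b) (k := e b) Wb); first lia.
- by move=> k _ [-> _]; rewrite /= /upd eqxx; regs.
- move=> k _ [-> kb]; apply: wp_seq; apply: wp_dec; apply: wp_if.
  have uk : u k = next_pair (u k.+1).
    by rewrite /u -iterS; congr (iter _ _ _); lia.
  rewrite Wb; last lia.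
  have -> : (upd (S k.+1).1 b ((S k.+1).1 b).-1, o).1 b.+1 = (u k.+1).1.
    by rewrite /=; regs.
  rewrite /S /= uk; case: (u k.+1) => -[|n] m /=.
    apply: wp_seq; apply: (wp_move Wb); [lia|lia|].
    by apply: wp_inc; split; last lia; stores.
  by apply: wp_seq; apply: wp_dec; apply: wp_inc; split; last lia; stores.
- by split=> //; rewrite /S /u subnn; stores.
Qed.

Lemma prim_pi1 f : prim f -> prim (fun x => pi1 (f x)).
Proof.
apply: prim_comp => b b0; exists (Unpair b ;; Move b.+1 b), b.+2 => W Wb e o.
apply: wp_seq; apply: wp_unpair => //; apply: (wp_move Wb); [lia|lia|].
by split=> // [|j jb]; regs.
Qed.

Lemma prim_pi2 f : prim f -> prim (fun x => pi2 (f x)).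
Proof.
apply: prim_comp => b b0; exists (Unpair b ;; Move b.+2 b), b.+2 => W Wb e o.
apply: wp_seq; apply: wp_unpair => //; apply: (wp_move Wb); [lia|lia|].
by split=> // [|j jb]; regs.
Qed.

Lemma prim_iter1 g : prim g -> prim (fun x => iter (pi2 x) g (pi1 x)).
Proof.
move=> pg b b0; have [c [R cP]] := pg b.+1 isT.
exists (Unpair b ;; Move b.+2 b ;; Until b 1 (Dec b ;; c) ;; Move b.+1 b),
  (maxn R b.+2) => W WR e o.
have Wb : marked W b.+2 by apply: markedW WR; lia.
have WRc : marked W R by apply: markedW WR; lia.
apply: wp_seq; apply: wp_unpair => //.
apply: wp_seq; apply: (wp_move Wb); [lia|lia|].
pose v s := iter (pi2 (e b) - s) g (pi1 (e b)).
pose Inv s (u : store) := [/\ u.2 = o, u.1 b = s, s <= pi2 (e b),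
  u.1 b.+1 = v s & forall j, j < b -> u.1 j = e j].
apply: wp_seq.
apply: (@wp_weaken _ _ (Inv 0)) => [|[e' _] [/= -> e'b _ e'v e'j]]; last first.
  apply: (wp_move Wb); [lia|lia|split=> //= [|j jb]]; last by regs; apply: e'j.
  by regs; rewrite e'b e'v /v subn0.
apply: (wp_loop (k := pi2 (e b)) Wb); first lia.
- by move=> k u [].
- move=> k [e1 _] [/= -> e1b kb e1v e1j]; apply: wp_seq; apply: wp_dec.
  apply: wp_weaken (cP W WRc _ o) _ => -[e2 _] /= [-> e2v e2j].
  split=> //=; [by rewrite e2j//; regs; rewrite e1b|lia| |].
    rewrite e2v; regs; rewrite e1v /v -iterS; f_equal; lia.
  by move=> j jb; rewrite e2j; [regs; apply: e1j|lia].
- split=> //=; first by regs.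
    by regs; rewrite /v subnn.
  by move=> j jb; regs.
Qed.

(** [prim_iter1] iterates a step without parameters; here the parameter travels unchanged in the
    first component of a pair. *)
Lemma prim_iter N A G : prim N -> prim A -> prim (fun y => G (pi1 y) (pi2 y)) ->
  prim (fun x => iter (N x) (G x) (A x)).
Proof.
move=> pN pA pG.
pose g y := cantor_pair (pi1 y) (G (pi1 y) (pi2 y)).
have pg : prim g by apply: prim_pair => //; apply: prim_pi1; apply: prim_id.
have gE x n a : iter n g (cantor_pair x a) = cantor_pair x (iter n (G x) a).
  by elim: n => // n IHn; rewrite !iterS IHn /g pi1K pi2K.
suff: prim (fun x => pi2 (iter (N x) g (cantor_pair x (A x)))).
  by congr prim; apply/funext => x; rewrite gE pi2K.
apply: prim_pi2.
suff: prim (fun x =>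
    (fun y => iter (pi2 y) g (pi1 y)) (cantor_pair (cantor_pair x (A x)) (N x))).
  by congr prim; apply/funext => x; rewrite /= pi1K pi2K.
apply: prim_comp (prim_iter1 pg) _; do 2?apply: prim_pair => //; exact: prim_id.
Qed.

(** * Arithmetic and boolean closure properties *)

Lemma eq_prim f g : f =1 g -> prim g -> prim f.
Proof. by move=> /funext ->. Qed.

Lemma prim_S f : prim f -> prim (fun x => (f x).+1).
Proof. exact: prim_comp prim_succ. Qed.

Lemma prim_add f g : prim f -> prim g -> prim (fun x => f x + g x).
Proof.
move=> pf pg; apply: eq_prim (prim_iter (G := fun _ => S) pg pf _) => [x|].
  by elim: (g x) => [|n IHn]; rewrite ?addn0// addnS IHn.
exact/prim_S/prim_pi2/prim_id.
Qed.

(** Iterating (n, m) -> (n + 1, n) from (0, 0), whose code is 0, leaves the second component one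
    step behind. *)
Lemma prim_pred f : prim f -> prim (fun x => (f x).-1).
Proof.
move=> pf; pose G (_ u : nat) := cantor_pair (pi1 u).+1 (pi1 u).
have pG : prim (fun y => G (pi1 y) (pi2 y)).
  by apply: prim_pair; [apply: prim_S|]; do 2?apply: prim_pi1; apply/prim_pi2/prim_id.
apply: eq_prim (prim_pi2 (prim_iter pf (prim_cst 0) pG)) => x.
suff -> : iter (f x) (G x) 0 = cantor_pair (f x) (f x).-1 by rewrite pi2K.
by elim: (f x) => // n; rewrite iterS => ->; rewrite /G pi1K.
Qed.

Lemma prim_sub f g : prim f -> prim g -> prim (fun x => f x - g x).
Proof.
move=> pf pg; apply: eq_prim (prim_iter (G := fun _ => predn) pg pf _) => [x|].
  by elim: (g x) => [|n IHn]; rewrite ?subn0// subnS IHn.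
exact/prim_pred/prim_pi2/prim_id.
Qed.

Lemma prim_mul f g : prim f -> prim g -> prim (fun x => f x * g x).
Proof.
move=> pf pg.
apply: eq_prim (prim_iter (G := fun x y => y + f x) pg (prim_cst 0) _) => [x|].
  by elim: (g x) => [|n IHn]; rewrite ?muln0// mulnS addnC IHn.
apply: prim_add; first exact/prim_pi2/prim_id.
exact/(prim_comp pf)/prim_pi1/prim_id.
Qed.

Lemma prim_leq f g : prim f -> prim g -> prim (fun x => f x <= g x).
Proof.
move=> pf pg; apply: eq_prim (prim_sub (prim_cst 1) (prim_sub pf pg)) => x.
by rewrite -subn_eq0; case: (_ - _).
Qed.

Lemma prim_andb P Q : prim (fun x => P x : bool) -> prim (fun x => Q x : bool) ->
  prim (fun x => P x && Q x).
Proof. by move=> pP pQ; apply: eq_prim (prim_mul pP pQ) => x; rewrite mulnb. Qed.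

Lemma prim_negb P : prim (fun x => P x : bool) -> prim (fun x => ~~ P x).
Proof. by move=> pP; apply: eq_prim (prim_sub (prim_cst 1) pP) => x; case: (P x). Qed.

Lemma prim_orb P Q : prim (fun x => P x : bool) -> prim (fun x => Q x : bool) ->
  prim (fun x => P x || Q x).
Proof.
move=> pP pQ.
apply: eq_prim (prim_negb (prim_andb (prim_negb pP) (prim_negb pQ))) => x.
by rewrite negb_and !negbK.
Qed.

Lemma prim_eq f g : prim f -> prim g -> prim (fun x => f x == g x).
Proof.
move=> pf pg; apply: eq_prim (prim_andb (prim_leq pf pg) (prim_leq pg pf)) => x.
by rewrite eqn_leq.
Qed.

Lemma prim_if P f g : prim (fun x => P x : bool) -> prim f -> prim g ->
  prim (fun x => if P x then f x else g x).
Proof.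
move=> pP pf pg.
apply: eq_prim (prim_add (prim_mul pP pf) (prim_mul (prim_negb pP) pg)) => x.
by case: (P x); rewrite mul1n mul0n ?addn0.
Qed.

(* Redefined whenever further closure properties become available.          *)
Ltac prim_ext := fail.

Ltac prim_step :=
  lazymatch goal with
  | |- prim (fun _ => ?c) => exact (prim_cst c)
  | |- prim (fun x => x) => exact prim_id
  | |- prim pi1 => apply (@prim_pi1 id)
  | |- prim pi2 => apply (@prim_pi2 id)
  | |- prim id => exact prim_id
  | |- prim (fun x => if _ then _ else _) => apply: prim_if
  | |- prim (fun x => cantor_pair (@?f x) (@?g x)) => apply (@prim_pair f g)
  | |- prim (fun x => pi1 (@?f x)) => apply (@prim_pi1 f)
  | |- prim (fun x => pi2 (@?f x)) => apply (@prim_pi2 f)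
  | |- prim (fun x => (@?f x).+1) => apply (@prim_S f)
  | |- prim (fun x => (@?f x).-1) => apply (@prim_pred f)
  | |- prim (fun x => @?f x + @?g x) => apply (@prim_add f g)
  | |- prim (fun x => @?f x - @?g x) => apply (@prim_sub f g)
  | |- prim (fun x => @?f x * @?g x) => apply (@prim_mul f g)
  | |- prim (fun x => nat_of_bool (@?f x <= @?g x)) => apply (@prim_leq f g)
  | |- prim (fun x => nat_of_bool (@?f x == @?g x)) => apply (@prim_eq f g)
  | |- prim (fun x => nat_of_bool (@?f x && @?g x)) => apply (@prim_andb f g)
  | |- prim (fun x => nat_of_bool (@?f x || @?g x)) => apply (@prim_orb f g)
  | |- prim (fun x => nat_of_bool (~~ @?f x)) => apply (@prim_negb f)
  | |- _ => first [assumption | prim_ext]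
  end.

Ltac prim := repeat prim_step.

Lemma prim_double f : prim f -> prim (fun x => (f x).*2).
Proof. by move=> pf; apply: eq_prim (prim_add pf pf) => x; rewrite addnn. Qed.

Lemma prim_exp2 f : prim f -> prim (fun x => 2 ^ f x).
Proof.
move=> pf; apply: eq_prim (prim_iter (G := fun _ => double) pf (prim_cst 1) _) => [x|].
  by elim: (f x) => // n IHn; rewrite iterS -IHn expnS mul2n.
by apply: prim_double; prim.
Qed.

Lemma prim_odd_half f : prim f ->
  prim (fun x => odd (f x)) /\ prim (fun x => (f x)./2).
Proof.
move=> pf; pose G (_ u : nat) := cantor_pair (1 - pi1 u) (pi1 u + pi2 u).
have pG : prim (fun y => G (pi1 y) (pi2 y)) by rewrite /G; prim.
have GE x n : iter n (G x) 0 = cantor_pair (odd n) n./2.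
  elim: n => // n; rewrite iterS => ->; rewrite /G pi1K pi2K /= uphalf_half.
  by case: (odd n).
have pit := prim_iter pf (prim_cst 0) pG.
by split; [apply: eq_prim (prim_pi1 pit)|apply: eq_prim (prim_pi2 pit)] => x;
  rewrite GE ?pi1K ?pi2K.
Qed.

(** * Lists of numbers *)

Notation code := CodeSeq.code.
Notation decode := CodeSeq.decode.

Definition primL (F : nat -> seq nat) := prim (fun x => code (F x)).

Lemma eq_primL F G : F =1 G -> primL G -> primL F.
Proof. by move=> /funext ->. Qed.

Lemma primL_cst l : primL (fun=> l).
Proof. exact: prim_cst. Qed.

Lemma primL_decode f : prim f -> primL (fun x => decode (f x)).
Proof. by apply: eq_prim => x; rewrite CodeSeq.decodeK. Qed.

(** This is the defining equation of [CodeSeq.code]: a list with head a and tail s has the code 2^a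
    (2 code(s) + 1), and the empty list has the code 0. *)
Lemma primL_cons f F : prim f -> primL F -> primL (fun x => f x :: F x).
Proof.
move=> pf pF; apply: (@eq_prim _ (fun x => 2 ^ f x * (code (F x)).*2.+1)) => //.
by apply: prim_mul (prim_exp2 pf) (prim_S (prim_double pF)).
Qed.

(* [strip n x = <a, y>] with [x = 2 ^ a * y] and [y] odd, provided [n] is large *)
Definition strip n x :=
  iter n (fun u => if odd (pi2 u) then u else cantor_pair (pi1 u).+1 (pi2 u)./2)
    (cantor_pair 0 x).

Lemma stripE n a y : a <= n -> odd y -> strip n (2 ^ a * y) = cantor_pair a y.
Proof.
move=> an oy; rewrite /strip; set G := fun _ => _.
suff gen k : iter n G (cantor_pair k (2 ^ a * y)) = cantor_pair (k + a) y by rewrite gen.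
rewrite /G; elim: n a an k => [|n IHn] [|a] an k //.
- by rewrite mul1n addn0.
- by have := IHn 0 isT k; rewrite iterSr mul1n pi2K oy addn0.
- rewrite iterSr pi2K pi1K expnS -mulnA mul2n odd_double doubleK.
  by rewrite IHn // addSnnS.
Qed.

(** Since a < 2^a, the exponent never exceeds the code, so the code itself bounds the number of
    halvings. *)
Lemma strip_code l n : code l <= n ->
  strip n (code l) = if l is a :: s then cantor_pair a (code s).*2.+1 else strip n 0.
Proof.
case: l => // a s; rewrite [code (a :: s)]/= => an; apply: stripE.
  apply: leq_trans an; apply: ltnW; apply: leq_trans (ltn_expl a (leqnn 2)) _.
  exact: leq_pmulr.
by rewrite /= odd_double.
Qed.

Lemma prim_strip f : prim f -> prim (fun x => strip (f x) (f x)).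
Proof.
move=> pf; apply: (prim_iter (N := f) (A := fun x => cantor_pair 0 (f x))
  (G := fun _ u => if odd (pi2 u) then u else cantor_pair (pi1 u).+1 (pi2 u)./2)) => //.
  by prim.
apply: prim_if; first by apply: (prim_odd_half _).1; prim.
  by prim.
by apply: prim_pair; [prim|apply: (prim_odd_half _).2; prim].
Qed.

Lemma prim_head F : primL F -> prim (fun x => nth 0 (F x) 0).
Proof.
move=> pF; apply: eq_prim (prim_pi1 (prim_strip pF)) => x.
by rewrite strip_code//; case: (F x) => [|a s] /=; rewrite pi1K.
Qed.

Lemma primL_behead F : primL F -> primL (fun x => behead (F x)).
Proof.
move=> pF; apply: eq_prim (prim_odd_half (prim_pi2 (prim_strip pF))).2 => x.
by rewrite strip_code//; case: (F x) => [|a s] //=; rewrite pi2K /= uphalf_double.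
Qed.

Lemma primL_iter N A (G : nat -> seq nat -> seq nat) :
  prim N -> primL A -> primL (fun y => G (pi1 y) (decode (pi2 y))) ->
  primL (fun x => iter (N x) (G x) (A x)).
Proof.
move=> pN pA pG.
apply: eq_prim (prim_iter (G := fun x c => code (G x (decode c))) pN pA pG) => x.
by elim: (N x) => // n IHn; rewrite !iterS -IHn CodeSeq.codeK.
Qed.

Lemma primL_comp F g : primL F -> prim g -> primL (fun x => F (g x)).
Proof. exact: (@prim_comp (fun x => code (F x))). Qed.

Lemma primL_drop f F : prim f -> primL F -> primL (fun x => drop (f x) (F x)).
Proof.
move=> pf pF; apply: eq_primL (primL_iter (G := fun _ => behead) pf pF _) => [x|].
  elim: (f x) => [|n IHn]; first by rewrite drop0.
  by rewrite iterS -IHn -drop1 drop_drop.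
by apply: primL_behead; apply: primL_decode; prim.
Qed.

Lemma prim_nth F f : primL F -> prim f -> prim (fun x => nth 0 (F x) (f x)).
Proof.
move=> pF pf; apply: eq_prim (prim_head (primL_drop pf pF)) => x.
by rewrite nth_drop addn0.
Qed.

Lemma leq_size_code l : size l <= code l.
Proof.
elim: l => //= a l IHl; rewrite -[X in X < _]mul1n.
apply: (@leq_trans (2 ^ a * (size l).+1)); first by rewrite mul1n leq_pmull ?expn_gt0.
by rewrite leq_mul2l ltnS (leq_trans IHl) ?orbT// -addnn leq_addr.
Qed.

(** The state pairs the accumulator with the code of the remaining list and idles once the list is
    empty. The code of the list is a sufficient number of rounds, being at least its length. *)
Lemma prim_foldl F A (G : nat -> nat -> nat -> nat) : primL F -> prim A ->
  prim (fun y => G (pi1 y) (pi1 (pi2 y)) (pi2 (pi2 y))) ->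
  prim (fun x => foldl (G x) (A x) (F x)).
Proof.
move=> pF pA pG.
pose G' x u := if pi2 u == 0 then u else
  cantor_pair (G x (pi1 u) (nth 0 (decode (pi2 u)) 0)) (code (behead (decode (pi2 u)))).
have G'E x n a l : size l <= n ->
    iter n (G' x) (cantor_pair a (code l)) = cantor_pair (foldl (G x) a l) 0.
  elim: n a l => [|n IHn] a [|b l] //; last first.
    move=> /(IHn (G x a b)) <-; rewrite iterSr /G' pi2K pi1K CodeSeq.codeK.
    by rewrite [code (b :: l)]/= muln_eq0 expn_eq0.
  by move=> _; rewrite -[RHS](IHn a [::])// iterSr /G' pi2K.
have pG' : prim (fun y => G' (pi1 y) (pi2 y)).
  rewrite /G'; apply: prim_if; [by prim|by prim|apply: prim_pair].
    apply: eq_prim (prim_comp pG (f := fun y => cantor_pair (pi1 y) (cantor_pair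
      (pi1 (pi2 y)) (nth 0 (decode (pi2 (pi2 y))) 0))) _).
      by move=> y; rewrite !(pi1K, pi2K).
    by prim; apply: prim_head; apply: primL_decode; prim.
  apply: (primL_behead (F := fun y => decode (pi2 (pi2 y)))).
  by apply: primL_decode; prim.
apply: eq_prim (prim_pi1 (prim_iter pF (prim_pair pA pF) pG')) => x.
by rewrite G'E ?pi1K ?leq_size_code.
Qed.

Lemma primL_foldl F A (G : nat -> seq nat -> nat -> seq nat) :
  primL F -> primL A ->
  primL (fun y => G (pi1 y) (decode (pi1 (pi2 y))) (pi2 (pi2 y))) ->
  primL (fun x => foldl (G x) (A x) (F x)).
Proof.
move=> pF pA pG.
apply: eq_prim (prim_foldl (G := fun x c a => code (G x (decode c) a)) pF pA pG) => x.
by elim/last_ind: (F x) => // s a IHs; rewrite !foldl_rcons -IHs CodeSeq.codeK.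
Qed.

Lemma prim_size F : primL F -> prim (fun x => size (F x)).
Proof.
move=> pF; apply: eq_prim (prim_foldl (G := fun _ n _ => n.+1) pF (prim_cst 0) _).
  by move=> x; rewrite -[LHS]addn0; elim: (F x) 0 => //= a s IHs n; rewrite -IHs addnS.
by prim.
Qed.

Lemma primL_catrev F G : primL F -> primL G -> primL (fun x => catrev (F x) (G x)).
Proof.
move=> pF pG.
apply: eq_primL (primL_foldl (G := fun _ l a => a :: l) pF pG _) => [x|].
  by elim: (F x) (G x) => //= a s IHs l; rewrite -IHs.
by apply: primL_cons; [prim|apply: primL_decode; prim].
Qed.

Lemma primL_rev F : primL F -> primL (fun x => rev (F x)).
Proof. by move=> pF; apply: primL_catrev pF (primL_cst [::]). Qed.

Lemma primL_cat F G : primL F -> primL G -> primL (fun x => F x ++ G x).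
Proof.
move=> pF pG; apply: eq_primL (primL_catrev (primL_rev pF) pG) => x.
by rewrite catrevE revK.
Qed.

Lemma primL_rcons F f : primL F -> prim f -> primL (fun x => rcons (F x) (f x)).
Proof.
move=> pF pf.
apply: eq_primL (primL_cat pF (primL_cons pf (primL_cst [::]))) => x.
by rewrite cats1.
Qed.

Lemma primL_if P F G : prim (fun x => P x : bool) -> primL F -> primL G ->
  primL (fun x => if P x then F x else G x).
Proof.
by move=> pP pF pG; apply: eq_prim (prim_if pP pF pG) => x; case: (P x).
Qed.

Ltac primL_step :=
  lazymatch goal with
  | |- prim (fun x => code (@?F x)) => change (primL F)
  | |- prim (fun x => nth 0 (@?F x) (@?f x)) => apply (@prim_nth F f)
  | |- prim (fun x => size (@?F x)) => apply (@prim_size F)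
  | |- primL (fun _ => ?c) => exact (primL_cst c)
  | |- primL (fun x => if _ then _ else _) => apply: primL_if
  | |- primL (fun x => decode (@?f x)) => apply (@primL_decode f)
  | |- primL (fun x => @?f x :: @?F x) => apply (@primL_cons f F)
  | |- primL (fun x => rcons (@?F x) (@?f x)) => apply (@primL_rcons F f)
  | |- primL (fun x => @?F x ++ @?G x) => apply (@primL_cat F G)
  | |- primL (fun x => drop (@?f x) (@?F x)) => apply (@primL_drop f F)
  | |- primL (fun x => behead (@?F x)) => apply (@primL_behead F)
  | |- primL (fun x => rev (@?F x)) => apply (@primL_rev F)
  end.

Ltac prim_ext ::= primL_step.

(** * Simulation of Turing machines on prefixes of the input *)

(* A function that differs finitely often from a given one is represented by *)
(* the list of its updates <argument, value>, the most recent one being last. *)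
Definition lookup (d : nat) (log : seq nat) (k : nat) :=
  foldl (fun v u => if pi1 u == k then pi2 u else v) d log.

Lemma lookup_rcons d log n a k :
  lookup d (rcons log (cantor_pair n a)) k = if k == n then a else lookup d log k.
Proof. by rewrite /lookup foldl_rcons pi1K pi2K eq_sym. Qed.

Lemma prim_lookup d F k : prim d -> primL F -> prim k ->
  prim (fun x => lookup (d x) (F x) (k x)).
Proof.
move=> pd pF pk.
apply: (prim_foldl (G := fun x v u => if pi1 u == k x then pi2 u else v)) => //.
apply: prim_if; [apply: prim_eq|..]; prim.
by apply: (prim_comp pk); prim.
Qed.

Definition tally_rev (l : seq nat) : seq nat :=
  foldl (fun w v => nseq v 1 ++ 0 :: w) [::] l.

Lemma tally_revE p n : tally_rev (rev (mkseq p n)) = Defs.tally p n.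
Proof.
rewrite /tally_rev foldl_rev /Defs.tally /mkseq.
rewrite (map_comp (fun v => rcons (nseq v 1) 0) p).
elim: (map p (iota 0 n)) => // a s IHs.
by rewrite [LHS]/= IHs /= cat_rcons.
Qed.

Lemma primL_tally_rev F : primL F -> primL (fun x => tally_rev (F x)).
Proof.
move=> pF; apply: (primL_foldl (G := fun _ w v => nseq v 1 ++ 0 :: w)) => //.
  by prim.
apply: primL_cat; last by prim.
apply: (@eq_primL _ (fun y => iter (pi2 (pi2 y)) (cons 1) [::])).
  by move=> y; elim: (pi2 (pi2 y)) => //= n ->.
by apply: (primL_iter (G := fun _ => cons 1)); prim.
Qed.

Ltac lookup_step :=
  lazymatch goal with
  | |- prim (fun x => lookup (@?d x) (@?F x) (@?k x)) => apply (@prim_lookup d F k)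
  | |- primL (fun x => tally_rev (@?F x)) => apply (@primL_tally_rev F)
  end.

Ltac prim_ext ::= first [primL_step | lookup_step].

Definition pack (s : nat) (hl wl o : seq nat) :=
  cantor_pair s (cantor_pair (code hl) (cantor_pair (code wl) (code o))).

Definition sim_state c := pi1 c.
Definition sim_heads c := decode (pi1 (pi2 c)).
Definition sim_cells c := decode (pi1 (pi2 (pi2 c))).
Definition sim_output c := decode (pi2 (pi2 (pi2 c))).

Definition sim_scan (w : seq nat) c t :=
  let h := lookup 0 (sim_heads c) t in
  lookup (if t == 0 then nth 0 w h else 0) (sim_cells c) (cantor_pair t h).

Definition sim_exec (w : seq nat) (i : seq nat) (c : nat) : nat :=
  let: s := sim_state c in
  let: hl := sim_heads c in
  let: wl := sim_cells c in
  let: o := sim_output c in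
  let: t := nth 0 i 1 in
  let: h := lookup 0 hl t in
  if nth 0 i 0 == 0 then pack s.+1 (rcons hl (cantor_pair t h.-1)) wl o
  else if nth 0 i 0 == 1 then pack s.+1 (rcons hl (cantor_pair t h.+1)) wl o
  else if nth 0 i 0 == 2 then
    pack s.+1 hl
      (if t == 0 then wl else rcons wl (cantor_pair (cantor_pair t h) (nth 0 i 2))) o
  else if nth 0 i 0 == 3 then pack s.+1 hl wl (rcons o t)
  else pack (if sim_scan w c t == nth 0 i 2 then nth 0 i 3 else nth 0 i 4) hl wl o.

Definition sim_step (m : nat) (w : seq nat) (c : nat) : nat :=
  if sim_state c < size (decode m)
  then sim_exec w (decode (nth 0 (decode m) (sim_state c))) c else c.

(* The argument [l] is a prefix of the input in reverse order; as many steps  *)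
(* are simulated as there are numbers in the prefix.                          *)
Definition sim (m : nat) (l : seq nat) : nat :=
  iter (size l) (sim_step m (tally_rev l)) (pack 0 [::] [::] [::]).

Definition halted (m : nat) (l : seq nat) : bool :=
  size (decode m) <= sim_state (sim m l).

(** In reverse order, reading one more number is a [cons], and shorter prefixes are obtained by
    [drop]. *)
Definition prefix_rev (p : baire) (s : nat) : seq nat := rev (mkseq p s).

(** The arbitrary default [d] on tape 0 expresses that the log of cells has no entry for the input
    tape, whose contents come from the prefix instead. *)
Definition represents (p : baire) (c : nat) (k : config) :=
  [/\ sim_state c = state k,
      forall t, lookup 0 (sim_heads c) t = Defs.head k t,
      forall t x d, lookup (if t == 0 then d else 0) (sim_cells c) (cantor_pair t x)
        = if t == 0 then d else cell k t x,
      cell k 0 = tape_of p & sim_output c = output k].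

Lemma packE s hl wl o (c := pack s hl wl o) :
  [/\ sim_state c = s, sim_heads c = hl, sim_cells c = wl & sim_output c = o].
Proof.
by rewrite /c /pack /sim_state /sim_heads /sim_cells /sim_output
  !(pi1K, pi2K, CodeSeq.codeK).
Qed.

Lemma cantor_pair_eq n k n' k' :
  (cantor_pair n k == cantor_pair n' k') = (n == n') && (k == k').
Proof.
apply/eqP/andP => [E|[/eqP-> /eqP-> //]].
by rewrite -(pi1K n k) -{2}(pi2K n k) E pi1K pi2K.
Qed.

Lemma sim_execE p w c k i : represents p c k ->
  nth 0 w (Defs.head k 0) = cell k 0 (Defs.head k 0) ->
  represents p (sim_exec w (decode i) c) (exec (instr_of i) k).
Proof.
case: k => s h cl o [/= sE hE clE pE oE] wE; rewrite /sim_exec /instr_of.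
case: (nth 0 (decode i) 0) => [|[|[|[|a]]]] /=.
- have [s' h' cl' o'] := packE (sim_state c).+1 (rcons (sim_heads c)
    (cantor_pair (nth 0 (decode i) 1) (lookup 0 (sim_heads c) (nth 0 (decode i) 1)).-1))
    (sim_cells c) (sim_output c).
  split; rewrite /= ?s' ?h' ?cl' ?o' ?sE// => t; rewrite lookup_rcons !hE /upd.
  by [].
- have [s' h' cl' o'] := packE (sim_state c).+1 (rcons (sim_heads c)
    (cantor_pair (nth 0 (decode i) 1) (lookup 0 (sim_heads c) (nth 0 (decode i) 1)).+1))
    (sim_cells c) (sim_output c).
  split; rewrite /= ?s' ?h' ?cl' ?o' ?sE// => t; rewrite lookup_rcons !hE /upd.
  by [].
- set t := nth 0 (decode i) 1.
  have [s' h' cl' o'] := packE (sim_state c).+1 (sim_heads c)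
    (if t == 0 then sim_cells c else rcons (sim_cells c) (cantor_pair
       (cantor_pair t (lookup 0 (sim_heads c) t)) (nth 0 (decode i) 2))) (sim_output c).
  split; rewrite /= ?s' ?h' ?cl' ?o' ?sE//.
    move=> t' x d; have [//|t0] := eqVneq t 0.
    rewrite lookup_rcons cantor_pair_eq clE hE /upd.
    have [->|t't] := eqVneq t' t; last by rewrite andFb.
    by rewrite (negPf t0) /=.
  by case: eqVneq => // t0; rewrite /upd eq_sym (negPf t0).
- have [s' h' cl' o'] := packE (sim_state c).+1 (sim_heads c) (sim_cells c)
    (rcons (sim_output c) (nth 0 (decode i) 1)).
  by split; rewrite /= ?s' ?h' ?cl' ?o' ?sE ?oE.
- set t := nth 0 (decode i) 1.
  have scanE : sim_scan w c t = cl t (h t).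
    rewrite /sim_scan clE hE; have [->|//] := eqVneq t 0; exact: wE.
  rewrite scanE.
  have [s' h' cl' o'] := packE (if cl t (h t) == nth 0 (decode i) 2
    then nth 0 (decode i) 3 else nth 0 (decode i) 4)
    (sim_heads c) (sim_cells c) (sim_output c).
  by split; rewrite /= ?s' ?h' ?cl' ?o'.
Qed.

Lemma head_step M c t : Defs.head (step M c) t <= (Defs.head c t).+1.
Proof.
rewrite /step; case: (onth M (state c)) => // i.
by case: c => s h w o; case: i => [t'|t'|t' a|a|t' a s1 s2] //=; rewrite /upd;
  case: eqP => // ->; lia.
Qed.

Lemma head_run M p n t : Defs.head (run M p n) t <= n.
Proof.
elim: n => // n IHn; rewrite /run iterS -/(run M p n).
exact: leq_trans (head_step _ _ _) _.
Qed.

(** After [u] steps no head is beyond cell [u], and [n] numbers occupy at least [n] cells of the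
    tape; hence the prefix shows every input cell scanned in the first [n] steps. *)
Lemma sim_run m p n u : u <= n ->
  represents p (iter u (sim_step m (Defs.tally p n)) (pack 0 [::] [::] [::]))
    (run (machine_of m) p u).
Proof.
elim: u => [_|u IHu un].
  have [s' h' cl' o'] := packE 0 [::] [::] [::].
  by split; rewrite /= ?s' ?h' ?cl' ?o'// /lookup /= => -[].
rewrite iterS /run iterS -/(run _ _ _); have := IHu (ltnW un).
move: (iter u _ _) => c cu; rewrite /sim_step /step; have [sE _ _ pE _] := cu.
rewrite -sE /machine_of onth_map.
have [lt|ge] := ltnP; last by rewrite onth_default.
rewrite onthE (nth_map 0)//=; apply: sim_execE => //.
rewrite pE (@tape_ofE p n)//; apply: leq_trans (leq_size_tally p n).
by apply: leq_ltn_trans un; apply: head_run.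
Qed.

Lemma sim_prefix m p n :
  represents p (sim m (prefix_rev p n)) (run (machine_of m) p n).
Proof. by rewrite /sim tally_revE size_rev size_mkseq; apply: sim_run. Qed.

Lemma halts_sim m p :
  halts (machine_of m) p <-> exists n, halted m (prefix_rev p n).
Proof.
have haltedE n : halted m (prefix_rev p n) =
    (size (machine_of m) <= state (run (machine_of m) p n)).
  by rewrite /halted; case: (sim_prefix m p n) => -> _ _ _ _; rewrite size_map.
by split=> -[n nP]; exists n; move: nP; rewrite haltedE.
Qed.

Lemma prim_sim m F : prim m -> primL F -> prim (fun x => sim (m x) (F x)).
Proof.
move=> pm pF.
have ph : prim (fun y => m (pi1 y)) by apply: (prim_comp pm); prim.
have pw : primL (fun y => tally_rev (F (pi1 y))).
  by prim; apply: (primL_comp pF); prim.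
apply: (prim_iter (G := fun x => sim_step (m x) (tally_rev (F x)))).
- by prim.
- by rewrite /pack; prim.
- rewrite /sim_step /sim_exec /sim_scan /pack.
  rewrite /sim_state /sim_heads /sim_cells /sim_output.
  cbv zeta; prim.
Qed.

Lemma prim_halted m F : prim m -> primL F -> prim (fun x => halted (m x) (F x)).
Proof. by move=> pm pF; rewrite /halted /sim_state; prim; apply: prim_sim. Qed.

(** * Turing machines that search along the input *)

Lemma prefix_revS p s : prefix_rev p s.+1 = p s :: prefix_rev p s.
Proof. by rewrite /prefix_rev mkseqS rev_rcons. Qed.

Lemma size_prefix_rev p s : size (prefix_rev p s) = s.
Proof. by rewrite size_rev size_mkseq. Qed.

(* Writes the markers, then alternates between adding i to register 1 and     *)
(* running the program until register 2 is nonzero. Adding i at the end keeps *)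
(* the addresses in the program independent of i.                             *)
Definition looper (R : nat) (c : cmd) (i : nat) : machine :=
  let m := compile R.+1 c in
  let e := R.+1 + size m in
  [seq Write t 1 | t <- iota 1 R] ++ Test 0 0 e e :: m ++
    rcons (nseq i (MoveR 1)) (Test 2 1 R.+1 (e + i).+1).

Definition instr_code (i : instr) : nat :=
  match i with
  | MoveL t => code [:: 0; t]
  | MoveR t => code [:: 1; t]
  | Write t a => code [:: 2; t; a]
  | Emit a => code [:: 3; a]
  | Test t a s1 s2 => code [:: 4; t; a; s1; s2]
  end.

Definition machine_index (M : machine) : nat := code (map instr_code M).

Lemma machine_of_index M : machine_of (machine_index M) = M.
Proof.
rewrite /machine_of /machine_index CodeSeq.codeK -map_comp -[RHS]map_id.
apply: eq_map => i /=.
by case: i => *; rewrite /instr_of CodeSeq.codeK.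
Qed.

(** The instance of the s-m-n theorem that is needed: [i] enters only through the number of
    [MoveR 1] and the last jump target. *)
Lemma prim_index_looper R c : prim (fun i => machine_index (looper R c i)).
Proof.
pose l := map instr_code [seq Write t 1 | t <- iota 1 R].
pose m := compile R.+1 c; pose e := R.+1 + size m.
have pn a : primL (fun i => nseq i a).
  apply: (@eq_primL _ (fun i => iter i (cons a) [::])) => [i|].
    by elim: i => //= i ->.
  by apply: (primL_iter (G := fun _ => cons a)); prim.
suff: primL (fun i => l ++ instr_code (Test 0 0 e e) :: map instr_code m ++
    rcons (nseq i (instr_code (MoveR 1))) (code [:: 4; 2; 1; R.+1; (e + i).+1])).
  apply: (@eq_primL (fun i => map instr_code (looper R c i))) => i.
  by rewrite /looper map_cat map_cons map_cat map_rcons map_nseq.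
by prim.
Qed.

Section Looper.
Variables (R : nat) (c : cmd) (i : nat) (p : baire).
Let M := looper R c i.
Let stop := R.+1 + size (compile R.+1 c) + i.

Definition marked_cells (t x : nat) : nat :=
  if t == 0 then tape_of p x else (0 < t <= R) && (x == 0).
Let W := marked_cells.

(** Runs are cut at the closing [Test], after [i] has been added; the first visit, before any run of
    the body, then looks like all others. *)
Definition checkpoint (s : store) := Config stop s.1 W s.2.

Lemma marked_marked_cells : marked W R.
Proof. by move=> t x tR; rewrite /W /marked_cells tR; case: eqP tR => // ->. Qed.

Lemma size_looper : size M = stop.+1.
Proof.
rewrite /M /looper !size_cat size_map size_iota /= size_cat size_rcons size_nseq.
by rewrite /stop; lia.
Qed.

Lemma looper_code :
  [/\ code_at M 0 [seq Write t 1 | t <- iota 1 R],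
      onth M R = Some (Test 0 0 (R.+1 + size (compile R.+1 c))
                                (R.+1 + size (compile R.+1 c))),
      code_at M R.+1 (compile R.+1 c),
      code_at M (R.+1 + size (compile R.+1 c)) (nseq i (MoveR 1)) &
      onth M stop = Some (Test 2 1 R.+1 stop.+1)].
Proof.
have M0 : code_at M 0 M by exists [::], [::]; rewrite cats0.
have [/code_at_catl Mw /code_at_catr] := conj M0 M0.
rewrite size_map size_iota => /code_at_cons[Mgoto Mc].
have [/code_at_catl Mbody /code_at_catr /code_at_rcons[Mi Mstop]] := conj Mc Mc.
by split=> //; rewrite /stop; move: Mstop; rewrite size_nseq.
Qed.

Lemma reaches_add k e o b : code_at M b (nseq k (MoveR 1)) ->
  reaches M (Config b e W o) (Config (b + k) (upd e 1 (e 1 + k)) W o).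
Proof.
elim: k e b => [|k IHk] e b.
  rewrite !addn0 => _; have -> : upd e 1 (e 1) = e.
    by apply/funext => t; rewrite /upd; case: eqP => // ->.
  exact: reaches_refl.
move=> /code_at_cons[Mb /IHk{}IHk]; apply: (reaches_step Mb) => /=.
rewrite addnS -addSn; have := IHk (upd e 1 (e 1).+1); congr (reaches _ _ _).
congr Config; apply/funext => t; rewrite /upd eqxx; case: eqP => // _; lia.
Qed.

Lemma reaches_start : reaches M (init p) (checkpoint (upd (fun=> 0) 1 i, [::])).
Proof.
have [Mw Mgoto _ Mi _] := looper_code.
pose V r (t x : nat) : nat :=
  if t == 0 then tape_of p x else (0 < t <= r) && (x == 0).
have writes r : r <= R -> reaches M (init p) (Config r (fun=> 0) (V r) [::]).
  elim: r => [_|r IHr rR].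
    have -> : Config 0 (fun=> 0) (V 0) [::] = init p; last exact: reaches_refl.
    congr Config; apply/funext => -[|t]; apply/funext => x; rewrite /V //=.
  apply: reaches_trans (IHr (ltnW rR)) _.
  have Mr : onth M r = Some (Write r.+1 1).
    have [l [m [-> /size0nil->]]] := Mw.
    rewrite /= onth_cat size_map size_iota rR onth_map onthE (nth_map 0) ?size_iota//=.
    by rewrite nth_iota.
  apply: (reaches_step Mr); have -> : exec (Write r.+1 1)
    (Config r (fun=> 0) (V r) [::]) = Config r.+1 (fun=> 0) (V r.+1) [::].
    rewrite /=; congr Config; apply/funext => t; apply/funext => x.
    by rewrite /upd /V; case: eqP => [->|t0]; regs.
  exact: reaches_refl.
apply: reaches_trans (writes R (leqnn R)) _.
apply: (reaches_step Mgoto); rewrite /= if_same.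
exact: (@reaches_add i (fun=> 0) [::] _ Mi).
Qed.

Lemma step_checkpoint s : 2 <= R -> step M (checkpoint s) =
  Config (if s.1 2 == 0 then R.+1 else stop.+1) s.1 W s.2.
Proof.
move=> R2; have [_ _ _ _ Mstop] := looper_code.
by rewrite /step [onth _ _]Mstop /= marked_marked_cells// eqb1.
Qed.

Lemma looper_next s Q : s.1 2 = 0 -> 2 <= R -> wp W c Q s ->
  exists2 s', Q s' & exists t, iter t.+1 (step M) (checkpoint s) =
    checkpoint (upd s'.1 1 (s'.1 1 + i), s'.2).
Proof.
move=> s2 R2 [s' ss' Qs']; exists s' => //.
have [_ _ Mc Mi _] := looper_code.
have [t tE] := reaches_trans (ss' _ _ Mc) (reaches_add s'.1 s'.2 Mi).
exists t; rewrite iterSr -[RHS]tE; congr (iter _ _ _).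
by rewrite step_checkpoint// s2.
Qed.

Lemma looper_halt s : s.1 2 != 0 -> 2 <= R ->
  reaches M (init p) (checkpoint s) -> halts M p.
Proof.
move=> s2 R2 [t tE]; exists t.+1.
by rewrite /run iterS tE step_checkpoint// (negPf s2) size_looper.
Qed.

(** Consecutive checkpoints are at least one step apart, so they occur at arbitrarily late times;
    but a halted machine never returns to a state inside the program. *)
Lemma looper_loop (P : store -> Prop) s0 :
  (forall s, P s -> exists2 s', P s' & exists t,
     iter t.+1 (step M) (checkpoint s) = checkpoint s') ->
  P s0 -> reaches M (init p) (checkpoint s0) -> ~ halts M p.
Proof.
move=> next Ps0 [t0 t0E].
have late n : exists2 t, n <= t & exists2 s, P s & run M p t = checkpoint s.
  elim: n => [|n [t nt [s /next[s' Ps' [u uE]] tE]]]; first by exists t0 => //; exists s0.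
  exists (u.+1 + t); first by rewrite addSn ltnS (leq_trans nt)// leq_addl.
  by exists s'; rewrite // /run iterD -/(run M p t) tE.
move=> [t tM]; have [u tu [s _ uE]] := late t.
suff: size M <= state (run M p u) by rewrite uE size_looper ltnn.
rewrite -(subnK tu) /run iterD -/(run M p t); elim: (u - t) => // k IHk.
by rewrite iterS /step onth_default.
Qed.

End Looper.

(* Register 1 holds a parameter n and register 3 the prefix that has been    *)
(* read so far; register 2 is the flag on which the machine halts.            *)
Definition stage (p : baire) (n s : nat) (o : seq nat) (u : store) :=
  [/\ u.1 0 = size (Defs.tally p s), u.1 1 = n, u.1 2 = 0,
      u.1 3 = code (prefix_rev p s) & u.2 = o].

Definition Query (c : cmd) := Copy 1 5 4 ;; Copy 3 6 4 ;; Pair 4 ;; c.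

Definition Read (c : cmd) := Clear 5 ;; Until 0 0 (Inc 0 ;; Inc 5) ;; Inc 0 ;;
  Copy 3 6 4 ;; Pair 4 ;; c ;; Clear 3 ;; Move 4 3.

Section Stages.
Variables (W : nat -> nat -> nat) (p : baire).
Hypotheses (W8 : marked W 8) (W0 : W 0 = tape_of p).

Lemma wp_query f c n s o u Q :
  (forall e o, wp W c (fun s => [/\ s.2 = o, s.1 4 = f (e 4) &
     forall j, j < 4 -> s.1 j = e j]) (e, o)) ->
  stage p n s o u ->
  (forall u', stage p n s o u' ->
     u'.1 4 = f (cantor_pair n (code (prefix_rev p s))) -> Q u') ->
  wp W (Query c) Q u.
Proof.
move=> cP; case: u => e _ [/= e0 e1 e2 e3 ->] QP.
apply: wp_seq; apply: (wp_copy W8) => //.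
apply: wp_seq; apply: (wp_copy W8) => //.
apply: wp_seq; apply: wp_pair => // e' e'4 e'j.
apply: wp_weaken (cP e' o) _ => -[e'' _] /= [-> e''4 e''j].
apply: QP; last by rewrite /= e''4 e'4; congr (f (cantor_pair _ _)).
by split=> //=; rewrite e''j// e'j.
Qed.

Lemma tape_of_tally s j : j <= p s ->
  tape_of p (size (Defs.tally p s) + j) = (j < p s).
Proof.
move=> js; rewrite (@tape_ofE p s.+1) Defs.tallyS.
  rewrite nth_cat ltnNge leq_addr /= addKn nth_rcons size_nseq nth_nseq.
  by case: ltngtP js.
by rewrite size_cat size_rcons size_nseq ltn_add2l.
Qed.

Lemma wp_read_number s e o Q : e 0 = size (Defs.tally p s) -> e 5 = 0 ->
  Q (upd (upd e 0 (size (Defs.tally p s) + p s)) 5 (p s), o) ->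
  wp W (Until 0 0 (Inc 0 ;; Inc 5)) Q (e, o).
Proof.
move=> e0 e5 Qs.
pose S j := (upd (upd e 0 (size (Defs.tally p s) + j)) 5 j, o).
have -> : (e, o) = S 0 by rewrite /S addn0; stores.
suff gen k j : k + j = p s -> wp W (Until 0 0 (Inc 0 ;; Inc 5)) Q (S j).
  by apply: (gen (p s)); rewrite addn0.
elim: k j => [|k IHk] j jk.
  apply: wp_until_stop; last by move: Qs; rewrite /S -jk.
  by rewrite W0 /= tape_of_tally; lia.
apply: wp_until_next.
  by rewrite W0 /= tape_of_tally; lia.
apply: wp_seq; apply: wp_inc; apply: wp_inc.
have := IHk j.+1; rewrite -addSnnS => /(_ jk); congr (wp _ _ _ _).
by rewrite /S addnS; stores.
Qed.

Lemma wp_read c n s o u Q :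
  (forall e o, wp W c (fun s => [/\ s.2 = o,
     s.1 4 = code (pi1 (e 4) :: decode (pi2 (e 4))) &
     forall j, j < 4 -> s.1 j = e j]) (e, o)) ->
  stage p n s o u -> (forall u', stage p n s.+1 o u' -> Q u') ->
  wp W (Read c) Q u.
Proof.
move=> cP; case: u => e _ [/= e0 e1 e2 e3 ->] QP.
apply: wp_seq; apply: (wp_clear W8) => //.
apply: wp_seq; apply: (@wp_read_number s) => //.
apply: wp_seq; apply: wp_inc; apply: wp_seq; apply: (wp_copy W8) => //.
apply: wp_seq; apply: wp_pair => // e' e'4 e'j.
apply: wp_seq; apply: wp_weaken (cP e' o) _ => -[e'' _] /= [-> e''4 e''j].
apply: wp_seq; apply: (wp_clear W8) => //; apply: (wp_move W8) => //.
apply: QP; split=> //=.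
- rewrite /upd /= e''j// e'j// /upd /= Defs.tallyS size_cat size_rcons size_nseq.
  by rewrite addnS.
- by rewrite /upd /= e''j// e'j.
- by rewrite /upd /= e''j// e'j.
- rewrite {1}/upd /= {1}/upd /= add0n {1}/upd /= e''4 e'4 pi1K pi2K prefix_revS.
  by rewrite /upd /= e3 CodeSeq.codeK.
Qed.

End Stages.

Lemma prim_cons : prim (fun x => code (pi1 x :: decode (pi2 x))).
Proof. by prim. Qed.

(** The machine reads on until [f] accepts the prefix. As its index is computed by [g], this reduces
    semidecidable sets to the halting of machines, by one reduction for all oracles. *)
Lemma halting_machine f : prim f -> exists g, prim g /\ forall p n,
  halts (machine_of (g n)) p <->
  exists s, f (cantor_pair n (code (prefix_rev p s))) <> 0.
Proof.
move=> pf; have [c [R1 cP]] := pf 4 isT; have [c' [R2 c'P]] := prim_cons (b := 4) isT.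
pose body := Query c ;; If 4 1 (Read c' ;; Clear 1) (Inc 2).
pose R := maxn (maxn R1 R2) 8.
exists (fun n => machine_index (looper R body n)); split; first exact: prim_index_looper.
move=> p n; rewrite machine_of_index.
pose W := marked_cells R p.
have WR : marked W R by exact: marked_marked_cells.
have W8 : marked W 8 by apply: markedW WR; rewrite /R; lia.
have WR1 : marked W R1 by apply: markedW WR; rewrite /R; lia.
have WR2 : marked W R2 by apply: markedW WR; rewrite /R; lia.
have two : 2 <= R by rewrite /R; lia.
have W0 : W 0 = tape_of p by [].
pose phi s := f (cantor_pair n (code (prefix_rev p s))).
have next s u : stage p n s [::] u -> exists2 u',
    (if phi s == 0 then stage p n s.+1 [::] u' else u'.1 2 != 0) &
    exists t, iter t.+1 (step (looper R body n)) (checkpoint R body n p u) =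
      checkpoint R body n p u'.
  (* The parameter is 0 here because the body clears register 1 and the looper adds [n]
     afterwards. *)
  move=> Su; pose Q (v : store) :=
    if phi s == 0 then stage p 0 s.+1 [::] v else v.1 2 != 0.
  have [v Qv vE] : exists2 v, Q v & exists t,
      iter t.+1 (step (looper R body n)) (checkpoint R body n p u) =
      checkpoint R body n p (upd v.1 1 (v.1 1 + n), v.2).
    apply: looper_next => //; first by case: Su.
    apply: wp_seq; apply: (wp_query W8 (cP W WR1) Su) => v Sv v4.
    apply: wp_if; rewrite -/W W8// v4 eqb1 -/(phi s) /Q; case: (phi s == 0).
      apply: wp_seq; apply: (wp_read W8 W0 (c'P W WR2) Sv) => -[e o] [/= e0 e1 e2 e3 oE].
      by apply: (wp_clear W8) => //; split.
    by case: v {Sv v4} => e o; apply: wp_inc.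
  exists (upd v.1 1 (v.1 1 + n), v.2) => //; move: Qv; rewrite /Q.
  by case: ifP => // _ [v0 v1 v2 v3 vo]; split=> //=; rewrite /upd /= v1.
have start : stage p n 0 [::] (upd (fun=> 0) 1 n, [::]) by [].
split=> [pM|[s phis]].
  apply: contrapT => no; have phi0 s : phi s == 0.
    by apply/eqP; apply: contrapT => phis; apply: no; exists s.
  case: (@looper_loop R body n p (fun u => exists s, stage p n s [::] u)
    (upd (fun=> 0) 1 n, [::])) => //; last 2 first.
  - by exists 0.
  - exact: reaches_start.
  move=> u [s /next[u' uu' uE]]; exists u' => //.
  by exists s.+1; move: uu'; rewrite phi0.
have reach k : k <= s -> halts (looper R body n) p \/ exists2 u, stage p n k [::] u &
    reaches (looper R body n) (init p) (checkpoint R body n p u).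
  elim: k => [_|k IHk ks].
    by right; exists (upd (fun=> 0) 1 n, [::]) => //; exact: reaches_start.
  case: (IHk (ltnW ks)) => [|[u /next[u' uu' [t tE]] u0]]; first by left.
  have u'0 : reaches (looper R body n) (init p) (checkpoint R body n p u').
    by apply: reaches_trans u0 _; exists t.+1.
  by move: uu'; case: ifP => _ uu'; [right; exists u'|left; apply: looper_halt uu' _ _].
have [//|[u /next[u' uu' [t tE]] u0]] := reach s (leqnn s).
move/eqP/negPf: phis; rewrite -/(phi s) => phis; rewrite phis in uu'.
apply: looper_halt uu' _ _ => //.
by apply: reaches_trans u0 _; exists t.+1.
Qed.

(** The function [f] answers with the value plus one, or with 0 if the machine has to read on. The
    prefix is kept from one [n] to the next, so an answer is required on all long prefixes and not
    just on one. *)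
Lemma producing_machine f : prim f -> exists M, forall p q,
  (forall n s, f (cantor_pair n (code (prefix_rev p s))) = 0 \/
     f (cantor_pair n (code (prefix_rev p s))) = (q n).+1) ->
  (forall n, exists s0, forall s, s0 <= s ->
     f (cantor_pair n (code (prefix_rev p s))) <> 0) ->
  produces M p q.
Proof.
move=> pf; have [c [R1 cP]] := pf 4 isT; have [c' [R2 c'P]] := prim_cons (b := 4) isT.
pose body := Query c ;;
  If 4 1 (Read c') (Dec 4 ;; Until 4 1 (Dec 4 ;; Out 1) ;; Out 0 ;; Inc 1).
pose R := maxn (maxn R1 R2) 8.
exists (looper R body 0) => p q fq fex.
pose W := marked_cells R p.
have WR : marked W R by exact: marked_marked_cells.
have W8 : marked W 8 by apply: markedW WR; rewrite /R; lia.
have WR1 : marked W R1 by apply: markedW WR; rewrite /R; lia.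
have WR2 : marked W R2 by apply: markedW WR; rewrite /R; lia.
have two : 2 <= R by rewrite /R; lia.
have W0 : W 0 = tape_of p by [].
pose phi n s := f (cantor_pair n (code (prefix_rev p s))).
pose at_stage n s := exists2 u, stage p n s (Defs.tally q n) u &
  reaches (looper R body 0) (init p) (checkpoint R body 0 p u).
have next n s : at_stage n s -> if phi n s == 0 then at_stage n s.+1 else at_stage n.+1 s.
  move=> [u Su u0]; pose Q (v : store) := if phi n s == 0
    then stage p n s.+1 (Defs.tally q n) v else stage p n.+1 s (Defs.tally q n.+1) v.
  suff wpQ : wp W body Q u.
    have [|v Qv [t tE]] := @looper_next R body 0 p u Q _ two wpQ; first by case: Su.
    have vE : (upd v.1 1 (v.1 1 + 0), v.2) = v.
      by case: v {Qv tE} => e o; rewrite addn0; stores.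
    rewrite vE in tE.
    have v0 : reaches (looper R body 0) (init p) (checkpoint R body 0 p v).
      by apply: reaches_trans u0 _; exists t.+1.
    by move: Qv; rewrite /Q; case: ifP => _ Sv; exists v.
  apply: wp_seq; apply: (wp_query W8 (cP W WR1) Su) => v Sv v4.
  apply: wp_if; rewrite -/W W8// v4 eqb1 -/(phi n s) /Q.
  case: (eqVneq (phi n s) 0) => [_|/eqP phis].
    by apply: (wp_read W8 W0 (c'P W WR2) Sv).
  have phiE : phi n s = (q n).+1 by have [] := fq n s.
  case: v Sv v4 => e o [/= e0 e1 e2 e3 ->]; rewrite -/(phi n s) phiE => e4.
  apply: wp_seq; apply: wp_dec; apply: wp_seq.
  pose S k := (upd e 4 k, Defs.tally q n ++ nseq (q n - k) 1).
  apply: (@wp_weaken _ _ (fun v => v = S 0 /\ 0 <= q n)) => [|_ [-> _]].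
    apply: (wp_loop (Inv := fun k v => v = S k /\ k <= q n) (k := q n) W8) => //.
    - by move=> k _ [-> _].
    - move=> k _ [-> kq]; apply: wp_seq; apply: wp_dec; apply: wp_out.
      split; last exact: ltnW.
      rewrite /S -cats1 -catA -[[:: 1]]/(nseq 1 1) -nseqD addn1 -subSn//.
      by stores.
    - by split=> //; rewrite /S subnn cats0 e4; stores.
  apply: wp_seq; apply: wp_out; apply: wp_inc; split=> //=.
    by rewrite /upd /= e1.
  by rewrite Defs.tallyS subn0 rcons_cat.
have stage0 : at_stage 0 0.
  by exists (upd (fun=> 0) 1 0, [::]); [|exact: reaches_start].
have advance n s : at_stage n s -> exists s', at_stage n.+1 s'.
  have [s0 s0P] := fex n; have [k] := ubnP (s0 - s); elim: k s => // k IHk s sk Sn.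
  have := next _ _ Sn; case: eqP => [phi0 Sn'|_ Sn']; last by exists s.
  apply: IHk Sn'; have : ~ s0 <= s by move=> /s0P.
  by move/negP; rewrite -ltnNge; lia.
have out n : exists s, at_stage n s.
  by elim: n => [|n [s /advance]]; first by exists 0.
move=> n; have [s [u [_ _ _ _ uo] [t tE]]] := out n; exists t.
by rewrite /run tE /= uo prefix_refl.
Qed.

(** * Relative semidecidability *)

Definition least (P : nat -> bool) (n : nat) := find P (iota 0 n).

Lemma leastS P n : least P n.+1 =
  if least P n < n then least P n else if P n then n else n.+1.
Proof.
rewrite /least -addn1 iotaD find_cat has_find size_iota add0n /=.
by case: ifP => // _; case: (P n); rewrite ?addn0 ?addn1.
Qed.

Lemma leastP P n : least P n < n -> P (least P n).
Proof.
move=> Pn; have := Pn; rewrite -{2}(size_iota 0 n) -has_find => /(nth_find 0).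
by rewrite nth_iota.
Qed.

Lemma least_lt (P : nat -> bool) n k : k < n -> P k -> least P n <= k.
Proof.
move=> kn Pk; rewrite leqNgt; apply/negP => /(before_find 0).
by rewrite nth_iota// Pk.
Qed.

Lemma prim_least (P : nat -> nat -> bool) N :
  prim (fun y => P (pi1 y) (pi2 y)) -> prim N -> prim (fun x => least (P x) (N x)).
Proof.
move=> pP pN.
pose G x u := cantor_pair (pi1 u).+1
  (if pi2 u < pi1 u then pi2 u else if P x (pi1 u) then pi1 u else (pi1 u).+1).
have GE x n : iter n (G x) 0 = cantor_pair n (least (P x) n).
  by elim: n => // n IHn; rewrite iterS IHn /G pi1K pi2K leastS.
have pG : prim (fun y => G (pi1 y) (pi2 y)).
  rewrite /G; prim.
  apply: (@eq_prim _ (fun y => P (pi1 (cantor_pair (pi1 y) (pi1 (pi2 y))))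
    (pi2 (cantor_pair (pi1 y) (pi1 (pi2 y)))))) => [y|]; first by rewrite pi1K pi2K.
  by apply: (prim_comp pP); prim.
by apply: eq_prim (prim_pi2 (prim_iter pN (prim_cst 0) pG)) => x; rewrite GE pi2K.
Qed.

Definition bex (P : nat -> bool) (n : nat) := least P n < n.

Lemma bexP (P : nat -> bool) n : reflect (exists2 k, k < n & P k) (bex P n).
Proof.
apply: (iffP idP) => [Pn|[k kn Pk]]; first by exists (least P n) => //; apply: leastP.
by rewrite /bex (leq_ltn_trans _ kn)// least_lt.
Qed.

Lemma prim_bex (P : nat -> nat -> bool) N :
  prim (fun y => P (pi1 y) (pi2 y)) -> prim N -> prim (fun x => bex (P x) (N x)).
Proof. by move=> pP pN; apply: prim_leq => //; apply/prim_S/prim_least. Qed.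

Lemma prim_compb (f : nat -> bool) g :
  prim (fun x => f x) -> prim g -> prim (fun x => f (g x)).
Proof. exact: (@prim_comp (fun x => nat_of_bool (f x))). Qed.

Definition prefix_code (p : baire) (s : nat) := code (prefix_rev p s).

Definition truncate (c s : nat) := code (drop (size (decode c) - s) (decode c)).

Lemma truncate_prefix p s t : s <= t -> truncate (prefix_code p t) s = prefix_code p s.
Proof.
move=> st; rewrite /truncate CodeSeq.codeK size_prefix_rev; congr code.
rewrite -{2}(subnK st); elim: (t - s) => [|d IHd]; first by rewrite drop0.
by rewrite addSn prefix_revS.
Qed.

Lemma size_prefix_code p s : size (decode (prefix_code p s)) = s.
Proof. by rewrite CodeSeq.codeK size_prefix_rev. Qed.

Lemma prim_truncate f g : prim f -> prim g -> prim (fun x => truncate (f x) (g x)).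
Proof. by move=> pf pg; rewrite /truncate; prim. Qed.

Lemma nth_prefix_rev p s k : k < s -> nth 0 (prefix_rev p s) (s - k.+1) = p k.
Proof.
move=> ks; rewrite nth_rev size_mkseq; last by lia.
by rewrite nth_mkseq; [congr p|]; lia.
Qed.

Section Semidecidable.
Variable I : Type.
Implicit Types (o q r : I -> baire) (P Q : I -> nat -> Prop).

(* [P i] is semidecidable relative to [o i] uniformly in [i]; the index set  *)
(* plays the role of the domain of a partial operator.                        *)
Definition sigma o P := exists f : nat -> bool,
  [/\ prim (fun x => f x),
      forall i n, P i n <-> exists s, f (cantor_pair n (prefix_code (o i) s)) &
      forall i n s t, s <= t -> f (cantor_pair n (prefix_code (o i) s)) ->
        f (cantor_pair n (prefix_code (o i) t))].

Lemma eq_sigma o P Q : (forall i n, P i n <-> Q i n) -> sigma o P -> sigma o Q.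
Proof.
by move=> PQ [f [pf fP fm]]; exists f; split=> // i n; rewrite -PQ.
Qed.

(** Dovetailing: on a prefix of length t all m <= t and all s <= t are tried, which also makes the
    search monotone in t. The successor in [l] turns the strict bound of [bex] into <=. *)
Lemma sigmaI o P (f : nat -> bool) : prim (fun x => f x) ->
  (forall i n, P i n <->
     exists m s, f (cantor_pair n (cantor_pair m (prefix_code (o i) s)))) ->
  sigma o P.
Proof.
move=> pf fP.
pose h x m s := f (cantor_pair (pi1 x) (cantor_pair m (truncate (pi2 x) s))).
pose l x := (size (decode (pi2 x))).+1.
exists (fun x => bex (fun m => bex (h x m) (l x)) (l x)).
have pl : prim l by rewrite /l; prim.
have hP i n t : reflect (exists m s, [/\ m <= t, s <= t &
    f (cantor_pair n (cantor_pair m (prefix_code (o i) s)))])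
    (bex (fun m => bex (h (cantor_pair n (prefix_code (o i) t)) m) t.+1) t.+1).
  apply: (iffP (bexP _ _)) => [[m mt /bexP[s st]]|[m [s [mt st fms]]]].
    rewrite /h pi1K pi2K truncate_prefix// => fms.
    by exists m, s.
  exists m => //; apply/bexP; exists s => //.
  by rewrite /h pi1K pi2K truncate_prefix.
have lE i n t : l (cantor_pair n (prefix_code (o i) t)) = t.+1.
  by rewrite /l pi2K size_prefix_code.
split.
- apply: (prim_bex (P := fun x m => bex (h x m) (l x)) _ pl).
  apply: (prim_bex (P := fun y s => h (pi1 y) (pi2 y) s)).
    by rewrite /h; apply: prim_compb => //; prim; apply: prim_truncate; prim.
  by apply: (prim_comp pl); prim.
- move=> i n; rewrite fP; split=> [[m [s fms]]|[t]].
    exists (maxn m s); rewrite lE; apply/hP.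
    by exists m, s; rewrite leq_maxl leq_maxr.
  by rewrite lE => /hP[m [s [_ _ fms]]]; exists m, s.
- move=> i n s t st; rewrite !lE => /hP[m [u [ms us fmu]]]; apply/hP.
  by exists m, u; rewrite (leq_trans ms)// (leq_trans us).
Qed.

Lemma sigma_sub o P g : prim g -> sigma o P -> sigma o (fun i n => P i (g n)).
Proof.
move=> pg [f [pf fP fm]].
exists (fun x => f (cantor_pair (g (pi1 x)) (pi2 x))); split.
- by apply: prim_compb => //; prim; apply: (prim_comp pg); prim.
- move=> i n; rewrite fP.
  by split=> -[s fs]; exists s; move: fs; rewrite pi1K pi2K.
- by move=> i n s t st; rewrite !(pi1K, pi2K); apply: fm.
Qed.

Lemma sigma_prim o (f : nat -> bool) : prim (fun x => f x) -> sigma o (fun _ n => f n).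
Proof.
move=> pf; exists (fun x => f (pi1 x)); split.
- by apply: prim_compb => //; prim.
- by move=> i n; split=> [fn|[s]]; [exists 0|]; rewrite pi1K.
- by move=> i n s t _; rewrite !pi1K.
Qed.

Lemma sigma_oracle o : sigma o (fun i x => o i (pi1 x) = pi2 x).
Proof.
pose f x := (pi1 (pi1 x) < size (decode (pi2 x))) &&
  (nth 0 (decode (pi2 x)) (size (decode (pi2 x)) - (pi1 (pi1 x)).+1) == pi2 (pi1 x)).
exists f; have fE i x s : f (cantor_pair x (prefix_code (o i) s)) =
    (pi1 x < s) && (o i (pi1 x) == pi2 x).
  rewrite /f pi1K pi2K size_prefix_code; case: ltnP => //= xs.
  by rewrite CodeSeq.codeK nth_prefix_rev.
split.
- by rewrite /f; prim.
- move=> i x; split=> [ox|[s]]; last by rewrite fE => /andP[_ /eqP].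
  by exists (pi1 x).+1; rewrite fE leqnn ox eqxx.
- by move=> i x s t st; rewrite !fE => /andP[xs ->]; rewrite (leq_trans xs).
Qed.

Lemma sigma_and o P Q : sigma o P -> sigma o Q -> sigma o (fun i n => P i n /\ Q i n).
Proof.
move=> [f [pf fP fm]] [g [pg gP gm]]; exists (fun x => f x && g x); split.
- exact: prim_andb.
- move=> i n; rewrite fP gP; split=> [[[s fs] [t gt]]|[s /andP[fs gs]]].
    exists (maxn s t); rewrite (fm _ _ _ _ (leq_maxl s t))//.
    by rewrite (gm _ _ _ _ (leq_maxr s t)).
  by split; exists s.
- by move=> i n s t st /andP[/(fm _ _ _ _ st)-> /(gm _ _ _ _ st)->].
Qed.

Lemma sigma_or o P Q : sigma o P -> sigma o Q -> sigma o (fun i n => P i n \/ Q i n).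
Proof.
move=> [f [pf fP fm]] [g [pg gP gm]]; exists (fun x => f x || g x); split.
- exact: prim_orb.
- move=> i n; rewrite fP gP; split=> [[[s fs]|[s gs]]|[s /orP[fs|gs]]].
  + by exists s; rewrite fs.
  + by exists s; rewrite gs orbT.
  + by left; exists s.
  + by right; exists s.
- move=> i n s t st /orP[/(fm _ _ _ _ st)->//|/(gm _ _ _ _ st)->].
  by rewrite orbT.
Qed.

Lemma sigma_ex o (P : I -> nat -> nat -> Prop) :
  sigma o (fun i y => P i (pi1 y) (pi2 y)) -> sigma o (fun i n => exists m, P i n m).
Proof.
move=> [f [pf fP _]].
apply: (sigmaI (f := fun x => f (cantor_pair (cantor_pair (pi1 x) (pi1 (pi2 x)))
  (pi2 (pi2 x))))).
  by apply: prim_compb => //; prim.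
move=> i n; split=> [[m]|[m [s]]].
  have := fP i (cantor_pair n m); rewrite pi1K pi2K => -> [s fs].
  by exists m, s; rewrite !(pi1K, pi2K).
rewrite !(pi1K, pi2K) => fs; exists m.
by have := fP i (cantor_pair n m); rewrite pi1K pi2K => ->; exists s.
Qed.

(** By monotonicity, one sufficiently long prefix confirms all of the finitely many instances. *)
Lemma sigma_all o (P : I -> nat -> nat -> Prop) N : prim N ->
  sigma o (fun i y => P i (pi1 y) (pi2 y)) ->
  sigma o (fun i n => forall k, k < N n -> P i n k).
Proof.
move=> pN [f [pf fP fm]].
have fPnk i n k : P i n k <->
    exists s, f (cantor_pair (cantor_pair n k) (prefix_code (o i) s)).
  by have := fP i (cantor_pair n k); rewrite pi1K pi2K.
exists (fun x => ~~ bex (fun k => ~~ f (cantor_pair (cantor_pair (pi1 x) k) (pi2 x)))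
  (N (pi1 x))).
split.
- apply: prim_negb; apply: (prim_bex (P := fun x k =>
    ~~ f (cantor_pair (cantor_pair (pi1 x) k) (pi2 x))) (N := fun x => N (pi1 x))).
    by apply: prim_negb; apply: prim_compb => //; prim.
  by apply: (prim_comp pN); prim.
- move=> i n; split=> [Pn|[s fs] k kN].
    have [s sP] : exists s, forall k, k < N n ->
        f (cantor_pair (cantor_pair n k) (prefix_code (o i) s)).
      elim: (N n) Pn => [|K IHK] Pn; first by exists 0.
      have [|s sP] := IHK; first by move=> k kK; apply: Pn; apply: leqW.
      have [t tP] := (fPnk i n K).1 (Pn K (ltnSn K)).
      exists (maxn s t) => k; rewrite ltnS leq_eqVlt => /predU1P[->|/sP].
        by apply: fm tP; exact: leq_maxr.
      by apply: fm; exact: leq_maxl.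
    exists s; rewrite pi1K pi2K; apply/bexP => -[k kN].
    by rewrite sP.
  apply/fPnk; exists s; move: fs; rewrite pi1K pi2K; apply: contraNT => nf.
  by apply/bexP; exists k.
- move=> i n s t st; rewrite !(pi1K, pi2K); apply: contra => /bexP[k kN nf].
  by apply/bexP; exists k => //; apply: contra nf; apply: fm.
Qed.

(** Each [F i] is total, so its values can be found by search once the graph is semidecidable. *)
Definition cfun o (F : I -> baire) := sigma o (fun i x => F i (pi1 x) = pi2 x).

Lemma sigma_graph o F g h : cfun o F -> prim g -> prim h ->
  sigma o (fun i x => F i (g x) = h x).
Proof.
move=> cF pg ph.
apply: (eq_sigma (P := fun i x => F i (pi1 (cantor_pair (g x) (h x)))
   = pi2 (cantor_pair (g x) (h x)))).
  by move=> i n; rewrite pi1K pi2K.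
by apply: (sigma_sub (P := fun i x => F i (pi1 x) = pi2 x)) cF; prim.
Qed.

(** The finitely many values of [q i] that are consulted are guessed as a code [c] and checked
    against the graph of [q i]. *)
Lemma sigma_trans o q P : cfun o q -> sigma q P -> sigma o P.
Proof.
move=> cq [f [pf fP _]].
pose ok i c := forall k, k < size (decode c) ->
  q i k = nth 0 (decode c) (size (decode c) - k.+1).
have okP i c : ok i c <-> exists s, c = prefix_code (q i) s.
  split=> [okc|[s ->] k]; last first.
    by rewrite size_prefix_code => ks; rewrite CodeSeq.codeK nth_prefix_rev.
  exists (size (decode c)); rewrite -[LHS]CodeSeq.decodeK; congr code.
  apply: (@eq_from_nth _ 0); first by rewrite size_prefix_rev.
  move=> k kc; have := okc (size (decode c) - k.+1).
  rewrite (_ : _ - (_ - _).+1 = k); last by lia.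
  move=> <-; last by lia.
  by rewrite -(@nth_prefix_rev (q i) (size (decode c))); [congr nth|]; lia.
apply: (eq_sigma (P := fun i n => exists c, ok i c /\ f (cantor_pair n c))).
  move=> i n; rewrite fP; split=> [[c [/okP[s ->] fs]]|[s fs]]; first by exists s.
  by exists (prefix_code (q i) s); split=> //; apply/okP; exists s.
apply: sigma_ex; apply: sigma_and; last first.
  by apply: (@sigma_prim _ (fun y => f (cantor_pair (pi1 y) (pi2 y))));
    apply: prim_compb => //; prim.
apply: sigma_all; first by prim.
by apply: sigma_graph => //; prim.
Qed.

Lemma cfun_trans o q r : cfun o q -> cfun q r -> cfun o r.
Proof. exact: sigma_trans. Qed.

Lemma cfun_refl o : cfun o o.
Proof. exact: sigma_oracle. Qed.

Lemma cfun_prim o f : prim f -> cfun o (fun=> f).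
Proof.
move=> pf; apply: (eq_sigma (P := fun i x => f (pi1 x) == pi2 x)).
  by move=> i x; split=> [/eqP|/eqP].
apply: (@sigma_prim _ (fun x => f (pi1 x) == pi2 x)); prim.
by apply: (prim_comp pf); prim.
Qed.

Lemma cfun_comp o F G : cfun o F -> cfun o G -> cfun o (fun i n => F i (G i n)).
Proof.
move=> cF cG; apply: (eq_sigma (P := fun i x =>
    exists m, G i (pi1 x) = m /\ F i m = pi2 x)).
  by move=> i x; split=> [[m [<-]]|]; last by exists (G i (pi1 x)).
by apply: sigma_ex; apply: sigma_and; apply: sigma_graph; prim.
Qed.

Lemma cfun_pair o F G : cfun o F -> cfun o G ->
  cfun o (fun i n => cantor_pair (F i n) (G i n)).
Proof.
move=> cF cG; apply: (eq_sigma (P := fun i x =>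
    F i (pi1 x) = pi1 (pi2 x) /\ G i (pi1 x) = pi2 (pi2 x))).
  move=> i x; split=> [[-> ->]|<-]; first by rewrite cantor_unpair.
  by rewrite pi1K pi2K.
by apply: sigma_and; apply: sigma_graph; prim.
Qed.

(** The witness [c] codes the course of values up to the argument, and each of its steps is
    verified. *)
Lemma cfun_rec o a (G F : I -> baire) : cfun o G -> (forall i, F i 0 = a) ->
  (forall i n, F i n.+1 = G i (cantor_pair n (F i n))) -> cfun o F.
Proof.
move=> cG F0 FS.
apply: (eq_sigma (P := fun i x => exists c,
  nth 0 (decode c) 0 == a /\ nth 0 (decode c) (pi1 x) == pi2 x /\
  forall k, k < pi1 x ->
    G i (cantor_pair k (nth 0 (decode c) k)) = nth 0 (decode c) k.+1)).
  move=> i x; split=> [[c [/eqP c0 [/eqP <- cS]]]|Fx].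
    have cF k : k <= pi1 x -> F i k = nth 0 (decode c) k.
      elim: k => [|k IHk kx]; first by rewrite F0 c0.
      by rewrite FS (IHk (ltnW kx)) cS.
    exact: cF.
  exists (code (mkseq (F i) (pi1 x).+1)); rewrite CodeSeq.codeK !nth_mkseq//.
  rewrite F0 Fx !eqxx; split=> //; split=> // k kx.
  by rewrite !nth_mkseq ?FS// leqW.
apply: sigma_ex; apply: sigma_and; [|apply: sigma_and].
- by apply: (@sigma_prim _ (fun y => nth 0 (decode (pi2 y)) 0 == a)); prim.
- by apply: (@sigma_prim _ (fun y =>
    nth 0 (decode (pi2 y)) (pi1 (pi1 y)) == pi2 (pi1 y))); prim.
- apply: sigma_all; first by prim.
  by apply: sigma_graph => //; prim.
Qed.

Lemma cfun_if o B F G : cfun o B -> cfun o F -> cfun o G ->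
  cfun o (fun i n => if B i n == 0 then F i n else G i n).
Proof.
move=> cB cF cG; apply: (eq_sigma (P := fun i x =>
  (B i (pi1 x) = 0 /\ F i (pi1 x) = pi2 x) \/
  (exists m, B i (pi1 x) = m.+1) /\ G i (pi1 x) = pi2 x)).
  move=> i x; case: (B i (pi1 x)) => [|m] /=.
    by split=> [[[]|[[]]]|]; last by left.
  by split=> [[[]|[_]]|]; last by right; split=> //; exists m.
apply: sigma_or; apply: sigma_and; try (by apply: sigma_graph => //; prim).
by apply: sigma_ex; apply: sigma_graph => //; prim.
Qed.

End Semidecidable.

(** * Machines and semidecidability *)

(** The blocks 1^x 0 delimit themselves: the first 0 shows where the first number ends. *)
Lemma tally_rev_inj l l' w : size l = size l' ->
  prefix (tally_rev (rev l)) w -> prefix (tally_rev (rev l')) w -> l = l'.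
Proof.
have cons_tally x s : tally_rev (rev (x :: s)) = nseq x 1 ++ 0 :: tally_rev (rev s).
  by rewrite /tally_rev !foldl_rev.
have index0 x s : index 0 (nseq x 1 ++ 0 :: s) = x.
  by rewrite index_cat mem_nseq andbF size_nseq /= addn0.
elim: l l' w => [|x l IHl] [|y l'] w //= [ll'].
rewrite !cons_tally => /prefixP[a ->] /prefixP[b].
rewrite -!catA !cat_cons => E.
have xy : x = y by rewrite -(index0 x (tally_rev (rev l) ++ a)) E index0.
move: E; rewrite xy => /(congr1 (drop (size (nseq y 1)))).
rewrite !drop_size_cat// => -[E]; congr cons.
apply: (IHl _ (tally_rev (rev l) ++ a)) => //; first exact: prefix_prefix.
by rewrite E prefix_prefix.
Qed.

Lemma prefix_run M p s t : s <= t -> prefix (output (run M p s)) (output (run M p t)).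
Proof.
move=> /subnK <-; elim: (t - s) => [|d IHd]; first exact: prefix_refl.
apply: prefix_trans IHd _; rewrite addSn /run iterS /step; case: (onth _ _) => [i|].
  by case: (iter _ _ _) => k h w o; case: i => *; rewrite /= ?prefix_refl// prefix_rcons.
exact: prefix_refl.
Qed.

(** Output is never erased, so this word and the one belonging to [q] are both prefixes of a later
    output. *)
Lemma produces_tally M p q l s : produces M p q ->
  prefix (tally_rev (rev l)) (output (run M p s)) -> l = mkseq q (size l).
Proof.
move=> Mpq pl; have [t tq] := Mpq (size l).
apply: (tally_rev_inj (w := output (run M p (maxn s t)))); first by rewrite size_mkseq.
  exact: prefix_trans pl (prefix_run _ _ (leq_maxl _ _)).
by rewrite tally_revE; apply: prefix_trans tq (prefix_run _ _ (leq_maxr _ _)).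
Qed.

Lemma produces_unique M p q q' : produces M p q -> produces M p q' -> q = q'.
Proof.
move=> Mpq Mpq'; apply/funext => n; have [t tq] := Mpq n.+1.
have := produces_tally (l := mkseq q n.+1) (s := t) Mpq'.
rewrite tally_revE => /(_ tq) /(congr1 (nth 0 ^~ n)).
by rewrite size_mkseq !nth_mkseq.
Qed.

Definition pfun_of (M : machine) : pfun baire baire :=
  PFun (graph := produces M) (@produces_unique M).

Lemma computable_pfun_of M : computable (pfun_of M).
Proof. by exists M. Qed.

Section Machines.
Variable I : Type.
Implicit Types (o q : I -> baire) (P : I -> nat -> Prop).

(** The witness consists of the first n + 1 output numbers, in reverse so that the value comes
    first, and of the rest of the output after [s] simulated steps. *)
Lemma cfun_produces o q M : (forall i, produces M (o i) (q i)) -> cfun o q.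
Proof.
move=> Moq; pose m := machine_index M.
apply: (sigmaI (f := fun y =>
  let: l := decode (pi1 (pi1 (pi2 y))) in
  let: r := decode (pi2 (pi1 (pi2 y))) in
  (size l == (pi1 (pi1 y)).+1) && (nth 0 l 0 == pi2 (pi1 y)) &&
  (code (sim_output (sim m (decode (pi2 (pi2 y))))) == code (tally_rev l ++ r)))).
  rewrite /sim_output; prim; apply: prim_sim; prim.
move=> i x; split=> [qx|[c [s]]]; last first.
  rewrite !(pi1K, pi2K) CodeSeq.codeK => /andP[/andP[/eqP sl /eqP l0]].
  have [_ _ _ _ ->] := sim_prefix m (o i) s.
  rewrite machine_of_index => /eqP/(can_inj CodeSeq.codeK) oE.
  have := produces_tally (l := rev (decode (pi1 c))) (s := s) (Moq i).
  rewrite revK oE prefix_prefix size_rev sl => /(_ isT) lE.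
  by rewrite -l0 -[decode _]revK lE nth_rev size_mkseq// subn1 nth_mkseq.
have [s /prefixP[r sE]] := Moq i (pi1 x).+1.
exists (cantor_pair (prefix_code (q i) (pi1 x).+1) (code r)), s.
rewrite !(pi1K, pi2K) !CodeSeq.codeK size_prefix_rev tally_revE prefix_revS /= qx.
have [_ _ _ _ ->] := sim_prefix m (o i) s.
by rewrite machine_of_index sE !eqxx.
Qed.

(* The function value that is confirmed by the semidecision procedure f for  *)
(* the graph with the prefix c of the oracle, plus one; 0 if there is none.   *)
Definition guess (f : nat -> bool) (n c : nat) :=
  let k := least (fun v => f (cantor_pair (cantor_pair n v) c)) (size (decode c)) in
  if k < size (decode c) then k.+1 else 0.

Lemma prim_guess f : prim (fun x => f x : bool) ->
  prim (fun x => guess f (pi1 x) (pi2 x)).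
Proof.
move=> pf; rewrite /guess.
have pl : prim (fun x => least (fun v => f (cantor_pair (cantor_pair (pi1 x) v) (pi2 x)))
    (size (decode (pi2 x)))).
  apply: (prim_least (P := fun x v => f (cantor_pair (cantor_pair (pi1 x) v) (pi2 x)))).
    by apply: prim_compb => //; prim.
  by prim.
by apply: prim_if; [apply: prim_leq; [exact: prim_S|prim]|exact: prim_S|prim].
Qed.

Lemma guessP o q : cfun o q -> exists f : nat -> bool,
  [/\ prim (fun x => f x),
      forall i n s, guess f n (prefix_code (o i) s) = 0 \/
        guess f n (prefix_code (o i) s) = (q i n).+1 &
      forall i n, exists s0, forall s, s0 <= s ->
        guess f n (prefix_code (o i) s) <> 0].
Proof.
move=> [f [pf fP fm]]; exists f; split=> //.
  move=> i n s; rewrite /guess; case: ifP => [/leastP fs|_]; [right|by left].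
  by congr S; apply/esym; have := (fP i _).2 (ex_intro _ s fs); rewrite pi1K pi2K.
move=> i n; have [|s0 s0P] := (fP i (cantor_pair n (q i n))).1.
  by rewrite pi1K pi2K.
(* [guess] only tries values below the length of the prefix, so the length must also exceed the
   value itself. *)
exists (maxn s0 (q i n).+1) => s; rewrite geq_max => /andP[s0s qs].
rewrite /guess size_prefix_code -/(bex _ s); case: (bexP _ s) => // -[].
by exists (q i n) => //; apply: fm s0P.
Qed.

Lemma produces_cfun o q : cfun o q -> exists M, forall i, produces M (o i) (q i).
Proof.
move=> /guessP[f [pf fq fex]]; have [M MP] := producing_machine (prim_guess pf).
exists M => i; apply: MP => [n s|n]; first by rewrite pi1K pi2K; apply: fq.
by have [s0 s0P] := fex i n; exists s0 => s; rewrite pi1K pi2K; apply: s0P.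
Qed.

Lemma J1P p n : J p n = 1 <-> halts (machine_of n) p.
Proof. by rewrite /J; case: asboolP. Qed.

Lemma J0P p n : J p n = 0 <-> J p n <> 1.
Proof. by rewrite /J; case: asboolP. Qed.

(** The jump is complete for semidecidability, with a reduction [g] that does not depend on the
    oracle. *)
Lemma sigma_halting o P : sigma o P ->
  exists g, prim g /\ forall i n, J (o i) (g n) = 1 <-> P i n.
Proof.
move=> [f [pf fP _]]; have [g [pg gP]] := halting_machine pf; exists g; split=> // i n.
rewrite J1P gP fP; split=> -[s fs]; exists s; move: fs.
  by rewrite -/(prefix_code (o i) s); case: (f _).
by rewrite /prefix_code => ->.
Qed.

Lemma sigma_J o : sigma o (fun i n => J (o i) n = 1).
Proof.
apply: (sigmaI (f := fun y => halted (pi1 y) (decode (pi2 (pi2 y))))).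
  by apply: prim_halted; prim.
move=> i n; rewrite J1P halts_sim; split=> [[s sn]|[m [s]]].
  by exists 0, s; rewrite !(pi1K, pi2K) CodeSeq.codeK.
by rewrite !(pi1K, pi2K) CodeSeq.codeK; exists s.
Qed.

Lemma halted_mono n p s t : s <= t ->
  halted n (prefix_rev p s) -> halted n (prefix_rev p t).
Proof.
rewrite /halted; have [-> _ _ _ _] := sim_prefix n p s.
have [-> _ _ _ _] := sim_prefix n p t.
move=> /subnK <- ns; elim: (t - s) => // d IHd.
by rewrite addSn /run iterS /step onth_default// size_map.
Qed.

(** * The Turing jump *)

Lemma sigma_jump o P : sigma o P -> sigma (fun i => J (o i)) P.
Proof.
move=> /sigma_halting[g [pg gP]]; apply: (eq_sigma gP).
apply: (sigma_graph (F := fun i => J (o i)) (h := fun=> 1)) => //; first exact: cfun_refl.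
exact: prim_cst.
Qed.

Lemma sigma_jumpC o P : sigma o P -> sigma (fun i => J (o i)) (fun i n => ~ P i n).
Proof.
move=> /sigma_halting[g [pg gP]].
apply: (eq_sigma (P := fun i n => J (o i) (g n) = 0)).
  by move=> i n; rewrite J0P gP.
apply: (sigma_graph (F := fun i => J (o i)) (h := fun=> 0)) => //; first exact: cfun_refl.
exact: prim_cst.
Qed.

(** The set decided by J(q) is semidecidable relative to q, hence relative to o; so J(o) semidecides
    both it and its complement. *)
Lemma cfun_jump o q : cfun o q -> cfun (fun i => J (o i)) (fun i => J (q i)).
Proof.
move=> cq; have cJ : sigma o (fun i n => J (q i) n = 1) := sigma_trans cq (sigma_J q).
apply: (eq_sigma (P := fun i x =>
  (J (q i) (pi1 x) = 1 /\ pi2 x == 1) \/ (J (q i) (pi1 x) <> 1 /\ pi2 x == 0))).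
  move=> i x; split=> [[[-> /eqP->]|[/J0P-> /eqP->]]|<-] //.
  by have [->|n1] := pselect (J (q i) (pi1 x) = 1); [left|right; rewrite (J0P _ _).2].
apply: sigma_or; apply: sigma_and.
- exact: sigma_sub (prim_pi1 prim_id) (sigma_jump cJ).
- by apply: (@sigma_prim _ _ (fun x => pi2 x == 1)); prim.
- exact: sigma_sub (prim_pi1 prim_id) (sigma_jumpC cJ).
- by apply: (@sigma_prim _ _ (fun x => pi2 x == 0)); prim.
Qed.

(** That some entry after N differs from v is semidecidable relative to o, so its negation is
    semidecidable relative to J(o); the limit is v if and only if the negation holds for some N. *)
Lemma cfun_lim o q : (forall i, Lim (o i) (q i)) -> cfun (fun i => J (o i)) q.
Proof.
move=> oq; apply: (eq_sigma (P := fun i x => exists N, ~ exists j,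
  N <= j /\ exists m, o i (cantor_pair j (pi1 x)) = m /\ m != pi2 x)).
  move=> i x; have /lim_graphP/(_ (pi1 x))[N NP] := oq i; split=> [[N' N'P]|qx].
    apply: contrapT => /eqP qx; apply: N'P; exists (maxn N N').
    split; first exact: leq_maxr.
    by exists (q i (pi1 x)); rewrite NP ?leq_maxl.
  by exists N => -[j [Nj [m [<-]]]]; rewrite NP// qx eqxx.
apply: sigma_ex; apply: (sigma_jumpC (P := fun i y => exists j, pi2 y <= j /\
  exists m, o i (cantor_pair j (pi1 (pi1 y))) = m /\ m != pi2 (pi1 y))).
apply: sigma_ex; apply: sigma_and.
  by apply: (@sigma_prim _ _ (fun y => pi2 (pi1 y) <= pi2 y)); prim.
apply: sigma_ex; apply: sigma_and.
  by apply: sigma_graph; [exact: cfun_refl|..]; prim.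
by apply: (@sigma_prim _ _ (fun y => pi2 y != pi2 (pi1 (pi1 (pi1 y))))); prim.
Qed.

Lemma prefix_codeS p s : prefix_code p s.+1 = code (p s :: decode (prefix_code p s)).
Proof. by rewrite /prefix_code CodeSeq.codeK prefix_revS. Qed.

Lemma eq_prefix_code (p r : baire) s : (forall k, k < s -> p k = r k) ->
  prefix_code p s = prefix_code r s.
Proof.
elim: s => // s IHs pr; rewrite !prefix_codeS pr// IHs// => k ks.
by apply: pr; apply: leqW.
Qed.

Lemma cfun_prefix_code o q : cfun o q -> cfun o (fun i => prefix_code (q i)).
Proof.
move=> cq; apply: (cfun_rec (a := 0)
  (G := fun i y => (fun u => code (pi1 u :: decode (pi2 (pi2 u))))
    (cantor_pair (q i (pi1 y)) y))) => // [|i n].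
  apply: (cfun_comp (F := fun i u => code (pi1 u :: decode (pi2 (pi2 u))))).
    by apply: cfun_prim; prim.
  apply: (cfun_pair (F := fun i y => q i (pi1 y)) (G := fun i y => y)).
    by apply: cfun_comp => //; apply: cfun_prim; prim.
  by apply: cfun_prim; prim.
by rewrite prefix_codeS !(pi1K, pi2K).
Qed.

(** The limit lemma. At stage t the jump is replaced by the set of machines that halt within t
    steps, and the computation from the jump is run on the shortest prefix of this approximation
    that yields a value. Any fixed prefix of the approximation is eventually correct. *)
Lemma cfun_limit_approximation o q : cfun (fun i => J (o i)) q ->
  exists2 s : I -> baire, cfun o s & forall i, Lim (s i) (q i).
Proof.
move=> /guessP[f [pf fq fex]].
pose approx c s := prefix_code (fun j => halted j (decode c)) s.
pose k n c := least (fun s => guess f n (approx c s) != 0) (size (decode c)).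
pose h x := (guess f (pi2 (pi1 x)) (approx (pi2 x) (k (pi2 (pi1 x)) (pi2 x)))).-1.
have p_approx C S : prim C -> prim S -> prim (fun x => approx (C x) (S x)).
  move=> pC pS; suff: primL (fun x =>
      iter (S x) (fun l => nat_of_bool (halted (size l) (decode (C x))) :: l) [::]).
    apply: eq_prim => x; elim: (S x) => // s IHs.
    rewrite iterS; set l := iter s _ _ in IHs *.
    have szl : size l = s by rewrite -[l]CodeSeq.codeK -IHs size_prefix_code.
    by rewrite /approx prefix_codeS -/(approx _ s) IHs CodeSeq.codeK szl.
  apply: (primL_iter (G := fun x l =>
    nat_of_bool (halted (size l) (decode (C x))) :: l)) => //; first by prim.
  prim; apply: (prim_halted (m := fun y => size (decode (pi2 y)))
    (F := fun y => decode (C (pi1 y)))); prim.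
  by apply: (prim_comp pC); prim.
have pk : prim (fun x => k (pi1 x) (pi2 x)).
  apply: (prim_least (P := fun x s => guess f (pi1 x) (approx (pi2 x) s) != 0)
    (N := fun x => size (decode (pi2 x)))); last by prim.
  prim; apply: (@eq_prim _ (fun y => (fun u => guess f (pi1 u) (pi2 u))
    (cantor_pair (pi1 (pi1 y)) (approx (pi2 (pi1 y)) (pi2 y))))).
    by move=> y; rewrite pi1K pi2K.
  apply: (prim_comp (prim_guess pf)); prim; apply: p_approx; prim.
have ph : prim h.
  rewrite /h; prim; apply: (@eq_prim _ (fun y => (fun u => guess f (pi1 u) (pi2 u))
    (cantor_pair (pi2 (pi1 y)) (approx (pi2 y) (k (pi2 (pi1 y)) (pi2 y)))))).
    by move=> y; rewrite pi1K pi2K.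
  apply: (prim_comp (prim_guess pf)); prim; apply: p_approx; prim.
  apply: (@eq_prim _ (fun y => (fun u => k (pi1 u) (pi2 u))
    (cantor_pair (pi2 (pi1 y)) (pi2 y)))); first by move=> y; rewrite pi1K pi2K.
  by apply: (prim_comp pk); prim.
(* A position codes a pair (t, k); its entry is the guess at stage t for the value at k. *)
exists (fun i n => h (cantor_pair n (prefix_code (o i) (pi1 n)))).
  apply: (cfun_comp (F := fun _ => h)); first exact: cfun_prim.
  apply: (cfun_pair (F := fun _ n => n)); first exact: cfun_prim prim_id.
  apply: (cfun_comp (F := fun i => prefix_code (o i))).
    exact/cfun_prefix_code/cfun_refl.
  exact: cfun_prim (prim_pi1 prim_id).
move=> i; apply/lim_graphP => n.
pose stable s t := forall j, j < s ->
  nat_of_bool (halted j (prefix_rev (o i) t)) = J (o i) j.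
have stableE s t : stable s t -> approx (prefix_code (o i) t) s = prefix_code (J (o i)) s.
  by move=> st; apply: eq_prefix_code => j js; rewrite CodeSeq.codeK st.
have stab s : exists N, forall t, N <= t -> stable s t.
  elim: s => [|s [N NP]]; first by exists 0.
  have [M MP] : exists M, forall t, M <= t ->
      nat_of_bool (halted s (prefix_rev (o i) t)) = J (o i) s.
    have [/J1P/halts_sim[M MP]|/J0P Js] := pselect (J (o i) s = 1).
      exists M => t Mt; rewrite (halted_mono Mt MP); apply/esym/J1P.
      by apply/halts_sim; exists M.
    exists 0 => t _; rewrite Js; case: (boolP (halted _ _)) => // st.
    by move/J0P: Js; case; apply/J1P/halts_sim; exists t.
  exists (maxn N M) => t; rewrite geq_max => /andP[Nt Mt] j.
  by rewrite ltnS leq_eqVlt => /predU1P[->|]; [exact: MP|exact: NP].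
(* Once the first [s0] bits are correct, the search over the approximation stops exactly at [s0], so
   wrong bits beyond are never consulted. *)
have [s0 s0P smin] : exists2 s0, guess f n (prefix_code (J (o i)) s0) != 0 &
    forall s, guess f n (prefix_code (J (o i)) s) != 0 -> s0 <= s.
  have [s sP] := fex i n; have ex : exists s, guess f n (prefix_code (J (o i)) s) != 0.
    by exists s; apply/eqP; apply: sP.
  by case: (ex_minnP ex) => s0; exists s0.
have [N NP] := stab s0.
exists (maxn N s0.+1) => t; rewrite geq_max => /andP[Nt st].
have stt := NP _ Nt.
rewrite /h !(pi1K, pi2K); set c := prefix_code _ t.
suff -> : k n c = s0.
  by rewrite stableE//; have [E|->//] := fq i n s0; rewrite E in s0P.
have stst s : s <= s0 -> approx c s = prefix_code (J (o i)) s.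
  by move=> ss0; apply: stableE => j js; apply: stt; apply: leq_trans ss0.
have ks0 : k n c <= s0.
  by apply: least_lt; rewrite ?size_prefix_code ?stst.
apply/eqP; rewrite eqn_leq ks0 smin// -stst//.
apply: (leastP (P := fun s => guess f n (approx c s) != 0)).
by apply: leq_ltn_trans ks0 _; rewrite size_prefix_code.
Qed.

End Machines.

(** * Jump inversion *)

Definition len (c : nat) := size (decode c).
Definition entry (c k : nat) := nth 0 (decode c) (len c - k.+1).

Lemma len_prefix_code p s : len (prefix_code p s) = s.
Proof. exact: size_prefix_code. Qed.

Lemma entry_prefix_code p s k : k < s -> entry (prefix_code p s) k = p k.
Proof. by move=> ks; rewrite /entry len_prefix_code CodeSeq.codeK nth_prefix_rev. Qed.

Lemma prefix_code_entry c : prefix_code (entry c) (len c) = c.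
Proof.
rewrite -[RHS]CodeSeq.decodeK; congr code.
apply: (@eq_from_nth _ 0); first by rewrite size_prefix_rev.
rewrite size_prefix_rev => k kc.
have -> : k = len c - (len c - k.+1).+1 by lia.
by rewrite nth_prefix_rev; [|lia].
Qed.

Lemma prim_len f : prim f -> prim (fun x => len (f x)).
Proof. by move=> pf; rewrite /len; prim. Qed.

Lemma prim_entry f g : prim f -> prim g -> prim (fun x => entry (f x) (g x)).
Proof. by move=> pf pg; rewrite /entry /len; prim. Qed.

Ltac entry_step :=
  lazymatch goal with
  | |- prim (fun x => len (@?f x)) => apply (@prim_len f)
  | |- prim (fun x => entry (@?f x) (@?g x)) => apply (@prim_entry f g)
  end.

Ltac prim_ext ::= first [primL_step | entry_step].

Definition extends (c d : nat) :=
  len c <= len d /\ forall k, k < len c -> entry d k = entry c k.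

Lemma extends_refl c : extends c c.
Proof. by []. Qed.

Lemma extends_trans d c e : extends c d -> extends d e -> extends c e.
Proof.
move=> [cd cdE] [de deE]; split=> [|k kc]; first exact: leq_trans de.
by rewrite deE ?cdE// (leq_trans kc).
Qed.

(* The argument is x = <e, <p|e, c>> with c the sequence built so far: the    *)
(* sequence t extends c, makes machine e halt, and its new entries in column  *)
(* positions k < e (where position <i, k> belongs to k) agree with p.         *)
Definition forces (x t : nat) : bool :=
  let: e := pi1 x in let: pe := pi1 (pi2 x) in let: c := pi2 (pi2 x) in
  [&& len c <= len t, ~~ bex (fun k => entry t k != entry c k) (len c),
      ~~ bex (fun k => [&& len c <= k, pi2 k < e & entry t k != entry pe (pi2 k)]) (len t)
    & halted e (decode t)].

Lemma prim_forces : prim (fun y => forces (pi1 y) (pi2 y)).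
Proof.
rewrite /forces; prim.
- apply: (prim_bex (P := fun y k => entry (pi2 y) k != entry (pi2 (pi2 (pi1 y))) k)
    (N := fun y => len (pi2 (pi2 (pi1 y))))); prim.
- apply: (prim_bex (P := fun y k => [&& len (pi2 (pi2 (pi1 y))) <= k,
    pi2 k < pi1 (pi1 y) & entry (pi2 y) k != entry (pi1 (pi2 (pi1 y))) (pi2 k)])
    (N := fun y => len (pi2 y))); prim.
- by apply: prim_halted; prim.
Qed.

Lemma forcesP p e c t :
  forces (cantor_pair e (cantor_pair (prefix_code p e) c)) t <->
  [/\ extends c t, forall k, len c <= k < len t -> pi2 k < e -> entry t k = p (pi2 k)
    & halted e (decode t)].
Proof.
rewrite /forces !(pi1K, pi2K); split.
  case/and4P => ct /bexP cE /bexP tE et; split=> //.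
    split=> // k kc; apply/eqP; apply: contrapT => /negP tk.
    by apply: cE; exists k.
  move=> k /andP[ck kt] ke; apply/eqP; apply: contrapT => /negP tk.
  by apply: tE; exists k; rewrite // ck ke entry_prefix_code.
move=> [[ct cE] tE ->]; rewrite ct andbT /=; apply/andP; split.
  by apply/bexP => -[k kc]; rewrite cE ?eqxx.
apply/bexP => -[k kt /and3P[ck ke]].
by rewrite entry_prefix_code// tE ?eqxx// ck.
Qed.

Definition force (x : nat) : nat :=
  if pselect (exists t, forces x t) is left ex then ex_minn ex else pi2 (pi2 x).

Lemma force_forces x : (exists t, forces x t) -> forces x (force x).
Proof.
by rewrite /force; case: pselect => // ex _; case: ex_minnP.
Qed.

Lemma force_no x : ~ (exists t, forces x t) -> force x = pi2 (pi2 x).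
Proof. by rewrite /force; case: pselect. Qed.

(** The graph of [force] is thus described by decidable conditions and the single question whether a
    forcing [t] exists, which 0' answers. *)
Lemma forceE x t : force x = t <->
  ((exists t, forces x t) /\ (forces x t && ~~ bex (forces x) t)) \/
  (~ (exists t, forces x t) /\ pi2 (pi2 x) == t).
Proof.
split=> [<-|[[ex /andP[xt nt]]|[no /eqP <-]]]; last exact: force_no.
  have [ex|no] := pselect (exists t, forces x t); [left|right].
    split=> //; rewrite /force; case: pselect => // ex'; case: ex_minnP => m -> mm /=.
    by apply/bexP => -[k km /mm]; rewrite leqNgt km.
  by split=> //; rewrite force_no.
rewrite /force; case: pselect => // ex'; case: ex_minnP => m xm mm.
apply/eqP; rewrite eqn_leq mm// leqNgt; apply/negP => tm.
by move/bexP: nt; apply; exists m.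
Qed.

(** The new position belongs to [pi2 (len c)], so its entry is the one that convergence to [p] asks
    for. Appending makes the approximations grow at every stage, even if nothing was forced. *)
Definition append (p : baire) (c : nat) := code (p (pi2 (len c)) :: decode c).

Lemma len_append p c : len (append p c) = (len c).+1.
Proof. by rewrite /append /len CodeSeq.codeK. Qed.

Lemma entry_append p c k : k <= len c ->
  entry (append p c) k = if k < len c then entry c k else p (pi2 (len c)).
Proof.
case: ltngtP => // [kc|->] _; last first.
  by rewrite /entry len_append subnn /append CodeSeq.codeK.
rewrite /entry len_append /append CodeSeq.codeK.
by have -> : (len c).+1 - k.+1 = (len c - k.+1).+1 by lia.
Qed.

Lemma extends_append p c : extends c (append p c).
Proof. by split=> [|k kc]; [rewrite len_append|rewrite entry_append ?kc// ltnW]. Qed.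

Fixpoint approximation (p : baire) (e : nat) : nat :=
  if e is e'.+1 then
    append p (force
      (cantor_pair e' (cantor_pair (prefix_code p e') (approximation p e'))))
  else 0.

(* The column limits of [generic p] are p and its jump is decided along with  *)
(* its construction.                                                          *)
Definition generic (p : baire) : baire :=
  fun x => entry (approximation p x.+1) x.

Section Generic.
Variable p : baire.
Let S := approximation p.
Let q e := cantor_pair e (cantor_pair (prefix_code p e) (S e)).

Lemma extends_force e : extends (S e) (force (q e)).
Proof.
have [/force_forces/forcesP[]//|no] := pselect (exists t, forces (q e) t).
by rewrite force_no// /q !pi2K.
Qed.

Lemma extends_approximationS e : extends (S e) (S e.+1).
Proof. exact: extends_trans (extends_force e) (extends_append _ _). Qed.

Lemma extends_approximation e e' : e <= e' -> extends (S e) (S e').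
Proof.
move=> /subnK <-; elim: (e' - e) => [|d IHd]; first exact: extends_refl.
exact: extends_trans IHd (extends_approximationS _).
Qed.

Lemma leq_len_approximation e : e <= len (S e).
Proof.
elim: e => // e IHe; rewrite /S /= len_append ltnS.
by apply: leq_trans IHe _; have [] := extends_force e.
Qed.

Lemma genericE e x : x < len (S e) -> generic p x = entry (S e) x.
Proof.
move=> xe; have [_ E] := extends_approximation (leq_maxl e x.+1).
have [_ E'] := extends_approximation (leq_maxr e x.+1).
by rewrite /generic -E -?E'// leq_len_approximation.
Qed.

Lemma prefix_code_generic e c : extends c (S e) -> prefix_code (generic p) (len c) = c.
Proof.
move=> [ce cE]; rewrite -[RHS]prefix_code_entry; apply: eq_prefix_code => k kc.
by rewrite (@genericE e) ?cE// (leq_trans kc).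
Qed.

Lemma generic_column e x : len (S e) <= x -> pi2 x < e -> generic p x = p (pi2 x).
Proof.
move=> ex xe; suff gen e' : e <= e' -> x < len (S e') -> entry (S e') x = p (pi2 x).
  have x1 := leq_trans (leq_len_approximation x.+1)
    (extends_approximation (leq_maxl x.+1 e)).1.
  by rewrite (genericE x1) gen// leq_maxr.
move=> /subnK <-; elim: (e' - e) => [|d IHd]; first by rewrite add0n ltnNge ex.
rewrite addSn /S /= -/S -/(q (d + e)) len_append ltnS => xlen.
rewrite entry_append//; case: ltngtP xlen => // [xf _|-> //].
have [xd|dx] := ltnP x (len (S (d + e))).
  by rewrite (extends_force _).2// IHd.
have [/force_forces/forcesP[_ E _]|no] := pselect (exists t, forces (q (d + e)) t).
  by rewrite E ?dx// (leq_trans xe)// leq_addl.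
by move: xf; rewrite force_no// /q !pi2K ltnNge dx.
Qed.

Lemma Lim_generic : Lim (generic p) p.
Proof.
apply/lim_graphP => k; exists (len (S k.+1)) => i ki.
have ik : len (S k.+1) <= cantor_pair i k by apply: leq_trans ki (cantor_pair_ge1 _ _).
by rewrite (generic_column ik) pi2K.
Qed.

(** If machine [e] halts on the final sequence, then a long prefix of that sequence is itself an
    admissible extension, as later entries obey the constraints of stage [e]. Conversely, a forcing
    extension that exists is built in. *)
Lemma J_generic e : J (generic p) e = 1 <-> exists t, forces (q e) t.
Proof.
rewrite J1P halts_sim; split=> [[n en]|].
  pose N := maxn n (len (S e)); exists (prefix_code (generic p) N); apply/forcesP; split.
  - split=> [|k ke]; rewrite ?len_prefix_code ?leq_maxr// entry_prefix_code.
      exact: genericE.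
    exact: leq_trans ke (leq_maxr _ _).
  - move=> k; rewrite len_prefix_code => /andP[ek kN] ke.
    by rewrite entry_prefix_code// (generic_column ek).
  - by rewrite CodeSeq.codeK; apply: halted_mono en; apply: leq_maxl.
move=> /force_forces/forcesP[_ _ et]; exists (len (force (q e))); move: et.
rewrite -{1}(@prefix_code_generic e.+1 (force (q e))) ?CodeSeq.codeK//.
exact: extends_append.
Qed.

End Generic.

(** * Oracle pairs, and the jump of the generic sequence *)

Lemma cfun_bpair I (o q r : I -> baire) : cfun o q -> cfun o r ->
  cfun o (fun i => bpair (q i) (r i)).
Proof.
move=> cq cr.
have [podd _] := prim_odd_half prim_id; have [_ phalf] := prim_odd_half prim_id.
have cB := cfun_if (cfun_prim o podd) (cfun_comp cq (cfun_prim o phalf))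
  (cfun_comp cr (cfun_prim o phalf)).
apply: eq_sigma cB => i x; rewrite /bpair /=.
by case: (odd (pi1 x)).
Qed.

Lemma cfun_bpairl I (q r : I -> baire) : cfun (fun i => bpair (q i) (r i)) q.
Proof.
have cB := cfun_comp (cfun_refl (fun i => bpair (q i) (r i)))
  (cfun_prim _ (prim_double prim_id)).
by apply: eq_sigma cB => i x; rewrite /bpair odd_double doubleK.
Qed.

Lemma cfun_bpairr I (q r : I -> baire) : cfun (fun i => bpair (q i) (r i)) r.
Proof.
have cB := cfun_comp (cfun_refl (fun i => bpair (q i) (r i)))
  (cfun_prim _ (prim_S (prim_double prim_id))).
by apply: eq_sigma cB => i x; rewrite /bpair /= odd_double /= uphalf_double.
Qed.

(** From 0' and p the stages of the construction can be retraced, and the answer of 0' to the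
    question asked at stage e is the e-th bit of the jump. *)
Lemma cfun_J_generic : cfun (fun p => bpair halting_problem p) (fun p => J (generic p)).
Proof.
set o := fun p => _.
have c0 : cfun o (fun=> halting_problem) := cfun_bpairl _ _.
have cid : cfun o id := cfun_bpairr _ _.
have sF I (o' : I -> baire) : sigma o' (fun _ x => exists t, forces x t).
  by apply: sigma_ex; apply: (@sigma_prim _ _ (fun y => forces (pi1 y) (pi2 y)));
    exact: prim_forces.
(* A one-point index set with the zero sequence as oracle, whose jump is 0' by definition. *)
have [g [pg gP]] := sigma_halting (sF unit (fun _ _ => 0)).
have {}gP x : halting_problem (g x) = 1 <-> exists t, forces x t by exact: gP tt x.
have cforce : cfun o (fun=> force).
  apply: (eq_sigma (P := fun _ y =>
    (halting_problem (g (pi1 y)) = 1 /\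
       (forces (pi1 y) (pi2 y) && ~~ bex (forces (pi1 y)) (pi2 y))) \/
    (halting_problem (g (pi1 y)) = 0 /\ pi2 (pi2 (pi1 y)) == pi2 y))).
    by move=> _ y; rewrite forceE J0P !gP.
  have pg1 : prim (fun y => g (pi1 y)) by apply: (prim_comp pg); prim.
  apply: sigma_or; apply: sigma_and.
  - exact: (sigma_graph c0 pg1 (prim_cst 1)).
  - apply: (@sigma_prim _ _ (fun y =>
      forces (pi1 y) (pi2 y) && ~~ bex (forces (pi1 y)) (pi2 y))).
    apply: prim_andb; first exact: prim_forces.
    apply: prim_negb; apply: (prim_bex (P := fun y t => forces (pi1 y) t)); last by prim.
    apply: (@eq_prim _ (fun y => (fun z => forces (pi1 z) (pi2 z))
      (cantor_pair (pi1 (pi1 y)) (pi2 y)))); first by move=> y; rewrite pi1K pi2K.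
    apply: (prim_compb (f := fun z => forces (pi1 z) (pi2 z)) prim_forces); prim.
  - exact: (sigma_graph c0 pg1 (prim_cst 0)).
  - by apply: (@sigma_prim _ _ (fun y => pi2 (pi2 (pi1 y)) == pi2 y)); prim.
have cappend : cfun o append.
  have := cfun_comp (F := fun _ u => code (pi1 u :: decode (pi2 u)))
    (cfun_prim o prim_cons) (cfun_pair (cfun_comp cid
      (cfun_prim o (prim_pi2 (prim_len prim_id)))) (cfun_prim o prim_id)).
  by apply: eq_sigma => p x; rewrite pi1K pi2K.
have cquery E F : cfun o E -> cfun o F ->
    cfun o (fun p x => cantor_pair (E p x) (cantor_pair (prefix_code p (E p x)) (F p x))).
  move=> cE cF; apply: (cfun_pair cE); apply: cfun_pair cF.
  exact: (cfun_comp (cfun_prefix_code cid) cE).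
have cS : cfun o approximation.
  apply: (cfun_rec (a := 0) (G := fun p y => append p (force (cantor_pair (pi1 y)
    (cantor_pair (prefix_code p (pi1 y)) (pi2 y)))))) => // [|p e]; last first.
    by rewrite /= pi1K pi2K.
  apply: (cfun_comp cappend); apply: (cfun_comp cforce).
  by apply: cquery; apply: cfun_prim; prim.
have := cfun_comp c0 (cfun_comp (cfun_prim o pg) (cquery _ _ (cfun_prim o prim_id) cS)).
apply: eq_sigma => p x; suff -> : J (generic p) (pi1 x) = halting_problem (g (cantor_pair
  (pi1 x) (cantor_pair (prefix_code p (pi1 x)) (approximation p (pi1 x))))) by [].
have [/[dup] /gP -> /J_generic //|no] := pselect (exists t, forces (cantor_pair (pi1 x)
  (cantor_pair (prefix_code p (pi1 x)) (approximation p (pi1 x)))) t).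
by transitivity 0; [|apply/esym]; apply/J0P; rewrite ?gP ?J_generic.
Qed.

(** * Problems *)

Lemma problem_computableP (X Y : rep_space) (f : problem X Y) :
  problem_computable X Y f <-> exists M, forall p x, delta X p x -> mvdom f x ->
    exists q y, [/\ produces M p q, delta Y q y & f x y].
Proof.
split=> [[F Ff [M MF]]|[M MP]]; last first.
  by exists (pfun_of M) => //; exact: computable_pfun_of.
exists M => p x px fx; have [q [y [Fpq qy fxy]]] := Ff p x px fx.
by exists q, y; split=> //; apply: MF.
Qed.

Lemma problem_computable_relP h (X Y : rep_space) (f : problem X Y) :
  problem_computable_rel h X Y f <-> exists M, forall p x, delta X p x -> mvdom f x ->
    exists q y, [/\ produces M (bpair h p) q, delta Y q y & f x y].
Proof.
split=> [[F Ff [G [M MG] GF]]|[M MP]].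
  exists M => p x px fx; have [q [y [Fpq qy fxy]]] := Ff p x px fx.
  by exists q, y; split=> //; apply: MG; apply: GF.
exists (PFun (graph := fun p q => produces M (bpair h p) q)
  (fun p => @produces_unique M (bpair h p))) => //.
by exists (pfun_of M) => //; exact: computable_pfun_of.
Qed.

Lemma problem_lowP (X Y : rep_space) (f : problem X Y) :
  problem_low X Y f <-> exists M, forall p x, delta X p x -> mvdom f x ->
    exists u q y, [/\ produces M p u, Lim u (J q), delta Y q y & f x y].
Proof.
split=> [[F Ff [G [M MG] FG]]|[M MP]].
  exists M => p x px fx; have [q [y [/FG[u Gpu [Jq uJq JE]] qy fxy]]] := Ff p x px fx.
  by exists u, q, y; split=> //; [exact: MG|by have -> : J q = Jq by exact: JE].
exists (Defs.pcomp L (pfun_of M)); last first.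
  by exists (pfun_of M) => //; exact: computable_pfun_of.
move=> p x px fx; have [u [q [y [pu uq qy fxy]]]] := MP p x px fx.
by exists q, y; split=> //; exists u => //; exists (J q).
Qed.

Theorem theorem4p8 (X Y : rep_space) (f : problem X Y) :
  [<-> problem_computable_rel halting_problem X Y f;
       problem_computable (H_space X) Y f;
       problem_computable (H_space X) (H_space Y) f;
       problem_computable (lim_space X) (lim_space Y) f;
       problem_low (lim_space X) (lim_space Y) f].
Proof.
have from_jump : problem_computable (H_space X) Y f ->
    exists M, forall r p x, Lim r p -> delta X p x -> mvdom f x ->
      exists q y, [/\ produces M (J r) q, delta Y q y & f x y].
  move=> /problem_computableP[M MP]; exists M => r p x rp px fx.
  by apply: MP fx; exists p => //; exists r.
split=> [/problem_computable_relP[M MP]|].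
  (* The index set consists of all triples of a name, its limit and the output of the given machine;
     over it the partial operator becomes a family of total sequences, and one machine [M'] serves
     all indices. *)
  pose I := {u : (baire * baire) * baire |
    Lim u.1.1 u.1.2 /\ produces M (bpair halting_problem u.1.2) u.2}.
  pose r (i : I) := (sval i).1.1; pose p (i : I) := (sval i).1.2.
  pose q (i : I) := (sval i).2.
  have ch : cfun (fun i => J (r i)) (fun=> halting_problem).
    by apply: (cfun_jump (q := fun _ _ => 0)); apply: cfun_prim; prim.
  have cp : cfun (fun i => J (r i)) p by apply: cfun_lim => i; case: (svalP i).
  have cq : cfun (fun i => bpair halting_problem (p i)) q.
    by apply: (cfun_produces (M := M)) => i; case: (svalP i).
  have [M' M'P] := produces_cfun (cfun_trans (cfun_bpair ch cp) cq).
  apply/problem_computableP; exists M' => _ x [p0 [r0 rp0 <-] px] fx.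
  have [q0 [y [Mq0 qy fxy]]] := MP p0 x px fx.
  by exists q0, y; split=> //; apply: (M'P (exist _ (r0, p0, q0) (conj rp0 Mq0))).
split=> [/from_jump[M MP]|].
  pose I := {u : baire * baire | produces M (J u.1) u.2}.
  pose r (i : I) := (sval i).1; pose q (i : I) := (sval i).2.
  have cq : cfun (fun i => J (r i)) q.
    by apply: (cfun_produces (M := M)) => i; exact: (svalP i).
  (* As [s] is computable from [r], its jump is computable from J(r), and J(s) is a name whose value
     under [Hinv] is [q]. *)
  have [s /cfun_jump/produces_cfun[M' M'P] sq] := cfun_limit_approximation cq.
  apply/problem_computableP; exists M' => _ x [p0 [r0 rp0 <-] px] fx.
  have [q0 [y [Mq0 qy fxy]]] := MP r0 p0 x rp0 px fx.
  pose i : I := exist _ (r0, q0) Mq0.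
  exists (J (s i)), y; split=> //; first exact: (M'P i).
  by exists q0 => //; exists (s i) => //; exact: (sq i).
split=> [/problem_computableP[M MP]|].
  pose I := {u : baire * baire * baire | produces M (J u.1.1) (J u.1.2) /\ Lim u.1.2 u.2}.
  pose r (i : I) := (sval i).1.1; pose t (i : I) := (sval i).1.2.
  pose q (i : I) := (sval i).2.
  have ct : cfun (fun i => J (r i)) (fun i => J (t i)).
    by apply: (cfun_produces (M := M)) => i; case: (svalP i).
  have cq : cfun (fun i => J (t i)) q by apply: cfun_lim => i; case: (svalP i).
  have [s /produces_cfun[M' M'P] sq] := cfun_limit_approximation (cfun_trans ct cq).
  apply/problem_computableP; exists M' => r0 x [p0 rp0 px] fx.
  have rx : delta (H_space X) (J r0) x by exists p0 => //; exists r0.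
  have [Jt [y [MJt [q0 [t0 tq0 E] qy] fxy]]] := MP _ _ rx fx.
  rewrite -E in MJt; pose i : I := exist _ (r0, t0, q0) (conj MJt tq0).
  exists (s i), y; split=> //; first exact: (M'P i).
  by exists q0 => //; exact: (sq i).
split=> [/problem_computableP[M MP]|].
  (* The value s0 computed in (4) is itself a low value: its jump is computable *)
  (* from J(r0) and hence limit computable from r0.                             *)
  pose I := {u : baire * baire | produces M u.1 u.2}.
  pose r (i : I) := (sval i).1; pose s (i : I) := (sval i).2.
  have cs : cfun r s by apply: (cfun_produces (M := M)) => i; exact: (svalP i).
  have [u /produces_cfun[M' M'P] us] := cfun_limit_approximation (cfun_jump cs).
  apply/problem_lowP; exists M' => r0 x rx fx.
  have [s0 [y [Ms0 sy fxy]]] := MP r0 x rx fx.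
  pose i : I := exist _ (r0, s0) Ms0.
  by exists (u i), s0, y; split=> //; exact: (M'P i).
move=> /problem_lowP[M MP].
pose I := {v : (baire * baire) * (baire * baire) |
  [/\ produces M (generic v.1.1) v.1.2, Lim v.1.2 (J v.2.1) & Lim v.2.1 v.2.2]}.
pose p (i : I) := (sval i).1.1; pose u (i : I) := (sval i).1.2.
pose t (i : I) := (sval i).2.1; pose q (i : I) := (sval i).2.2.
have cu : cfun (fun i => generic (p i)) u.
  by apply: (cfun_produces (M := M)) => i; case: (svalP i).
(* The output [u] of the low realizer only converges to J(t); its jump is needed to compute this
   limit. *)
have ct : cfun (fun i => J (u i)) (fun i => J (t i)).
  by apply: cfun_lim => i; case: (svalP i).
have cq : cfun (fun i => J (t i)) q by apply: cfun_lim => i; case: (svalP i).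
(* [cfun_J_generic] is indexed by all of Baire space and is pulled back along [p] to the present
   index set. *)
have cg : cfun (fun i => bpair halting_problem (p i)) (fun i => J (generic (p i))).
  have [g [pg gP gm]] := cfun_J_generic.
  by exists g; split=> // i; apply: gm.
have [M' M'P] := produces_cfun
  (cfun_trans (cfun_trans (cfun_trans cg (cfun_jump cu)) ct) cq).
apply/problem_computable_relP; exists M' => p0 x px fx.
have gx : delta (lim_space X) (generic p0) x by exists p0 => //; exact: Lim_generic.
have [u0 [t0 [y [Mu0 ut0 [q0 tq0 qy] fxy]]]] := MP _ _ gx fx.
exists q0, y; split=> //.
exact: (M'P (exist _ ((p0, u0), (t0, q0)) (And3 Mu0 ut0 tq0))).
Qed.
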